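(* If $T$ is an $\mathrm{NTP}_2$ theory, then forking in $T$ satisfies the chain condition over every extension base $C$.
   Context: $T$ is a complete first-order theory and we work in a monster model $\mathbb{M}\models T$. Forking and dividing have their usual meaning. $\mathrm{NTP}_2$: a formula $\varphi(x,y)$ is $\mathrm{TP}_2$ if there are $(a_{ij})_{i,j\in\omega}$ and $k\in\omega$ such that $\{\varphi(x,a_{ij})\}_{j\in\omega}$ is $k$-inconsistent for each $i\in\omega$, while $\{\varphi(x,a_{if(i)})\}_{i\in\omega}$ is consistent for each $f:\omega\to\omega$. $T$ is $\mathrm{NTP}_2$ if no formula is $\mathrm{TP}_2$. A set $C$ is an extension base if every type in $S(C)$ does not fork over $C$ (equivalently, every complete type over $C$ has a global extension which does not fork over $C$). Forking in $T$ satisfies the chain condition over a set $A$ if whenever $(a_i)_{i\in\omega}$ is an $A$-indiscernible sequence and $\varphi(x,a_0)$ does not fork over $A$, then $\varphi(x,a_0)\wedge\varphi(x,a_1)$ does not fork over $A$. *)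

(* Defs.v *)
From mathcomp Require Import all_boot.
From mathcomp Require Import boolp classical_sets functions cardinality.

Set Implicit Arguments.
Unset Strict Implicit.
Unset Printing Implicit Defensive.

Local Open Scope classical_set_scope.
Local Open Scope card_scope.

Record language := Language {
  fsym : Type;
  far : fsym -> nat;
  rsym : Type;
  rar : rsym -> nat }.

(* [formula L V] is the type of [L]-formulas whose free variables lie in [V].
   A quantifier binds the variable [None] of [option V]. *)

Inductive term (L : language) (V : Type) : Type :=
| Var of V
| App (f : fsym L) of ('I_(far f) -> term L V).

Inductive formula (L : language) (V : Type) : Type :=
| Eq of term L V & term L V
| Rel (r : rsym L) of ('I_(rar r) -> term L V)
| Not of formula L V
| And of formula L V & formula L V
| Ex of formula L (option V).

Fixpoint trename L V W (r : V -> W) (t : term L V) : term L W :=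
  match t with
  | Var v => Var L (r v)
  | App f ts => App (fun i => trename r (ts i))
  end.

Fixpoint rename L V W (r : V -> W) (phi : formula L V) : formula L W :=
  match phi with
  | Eq t u => Eq (trename r t) (trename r u)
  | Rel s ts => Rel (fun i => trename r (ts i))
  | Not p => Not (rename r p)
  | And p q => And (rename r p) (rename r q)
  | Ex p => Ex (rename (omap r) p)
  end.

Fixpoint tvars_in L V (P : V -> Prop) (t : term L V) : Prop :=
  match t with
  | Var v => P v
  | App f ts => forall i, tvars_in P (ts i)
  end.

Fixpoint vars_in L V (P : V -> Prop) (phi : formula L V) : Prop :=
  match phi with
  | Eq t u => tvars_in P t /\ tvars_in P u
  | Rel s ts => forall i, tvars_in P (ts i)
  | Not p => vars_in P p
  | And p q => vars_in P p /\ vars_in P q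
  | Ex p => vars_in (fun o => if o is Some v then P v else True) p
  end.

Record structure (L : language) := Structure {
  carrier :> Type;
  nonempty : inhabited carrier;
  fint : forall f : fsym L, ('I_(far f) -> carrier) -> carrier;
  rint : forall r : rsym L, ('I_(rar r) -> carrier) -> Prop }.

Fixpoint teval L (M : structure L) V (v : V -> M) (t : term L V) : M :=
  match t with
  | Var x => v x
  | App f ts => fint (fun i => teval v (ts i))
  end.

Fixpoint sat L (M : structure L) V (v : V -> M) (phi : formula L V) : Prop :=
  match phi with
  | Eq t u => teval v t = teval v u
  | Rel r ts => rint (fun i => teval v (ts i))
  | Not p => ~ sat v p
  | And p q => sat v p /\ sat v q
  | Ex p => exists m : M, sat (fun o => if o is Some x then v x else m) p
  end.

Definition sentence L := formula L void.

Definition models L (M : structure L) (T : set (sentence L)) : Prop :=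
  forall s, T s -> sat (of_void M) s.

Definition entails L (T : set (sentence L)) (s : sentence L) : Prop :=
  forall M : structure L, models M T -> sat (of_void M) s.

Definition complete_theory L (T : set (sentence L)) : Prop :=
  (exists M : structure L, models M T) /\
  (forall s, entails T s \/ entails T (Not s)).

(* An [L(M)]-formula in the variables [x_0, ..., x_(n-1)]: a variable [inr m]
   is the parameter [m], and is always evaluated at [m]. *)
Definition pformula L (M : structure L) (n : nat) := formula L ('I_n + M).

Section Structure.
Context (L : language) (M : structure L).
Implicit Types (A C : set M) (n m k : nat).

Definition psat n (x : 'I_n -> M) (theta : pformula M n) : Prop :=
  sat (fun v => match v with inl i => x i | inr c => c end) theta.

Definition over A {n} : set (pformula M n) :=
  [set theta | vars_in (fun v => if v is inr c then A c else True) theta].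

(* The instance [phi(x, a)] of the formula [phi(x, y)]. *)
Definition inst n m (phi : formula L ('I_n + 'I_m)) (a : 'I_m -> M)
    : pformula M n :=
  rename (fun v => match v with inl i => inl i | inr j => inr (a j) end) phi.

(* Finite satisfiability in [M], i.e. consistency with the elementary diagram
   of [M]. *)
Definition consistent n (p : set (pformula M n)) : Prop :=
  forall F : set (pformula M n), finite_set F -> F `<=` p ->
    exists x : 'I_n -> M, forall theta, F theta -> psat x theta.

Definition tp n A (a : 'I_n -> M) : set (pformula M n) :=
  [set theta | over A theta /\ psat a theta].

(* [S_n(A)] *)
Definition complete_types n A : set (set (pformula M n)) :=
  [set p | [/\ p `<=` over A, consistent p &
             forall theta, over A theta -> p theta \/ p (Not theta)]].

(* A cardinal is represented by a type [K]; this says that [A] has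
   cardinality smaller than [K]. *)
Definition small (K : Type) A : Prop := ~ ([set: K] #<= A).

Definition saturated (K : Type) : Prop :=
  forall A, small K A -> forall p, complete_types (n := 1) A p ->
    exists x : 'I_1 -> M, forall theta, p theta -> psat x theta.

Definition elementary_on A (f : M -> M) : Prop :=
  forall n (phi : formula L 'I_n) (a : 'I_n -> M), (forall i, A (a i)) ->
    (sat a phi <-> sat (f \o a) phi).

Definition automorphism (f : M -> M) : Prop :=
  [/\ bijective f,
      forall (s : fsym L) (a : 'I_(far s) -> M),
        f (fint a) = fint (f \o a) &
      forall (s : rsym L) (a : 'I_(rar s) -> M),
        rint a <-> rint (f \o a)].

Definition strongly_homogeneous (K : Type) : Prop :=
  forall A (f : M -> M), small K A -> elementary_on A f ->
    exists2 g : M -> M, automorphism g & forall x, A x -> g x = f x.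

(* Of the cardinal [K] we only ask that it exceed [|L| + aleph_0]; this covers
   stronger requirements such as being a strong limit. *)
Definition monster (K : Type) (T : set (sentence L)) : Prop :=
  [/\ models M T,
      ~ ([set: K] #<= [set: fsym L + rsym L + nat]),
      saturated K & strongly_homogeneous K].

Definition k_inconsistent n k (theta : nat -> pformula M n) : Prop :=
  forall j : 'I_k -> nat, injective j ->
    ~ exists x : 'I_n -> M, forall i, psat x (theta (j i)).

Definition indiscernible m A (a : nat -> 'I_m -> M) : Prop :=
  forall k (phi : formula L ('I_k * 'I_m + M)) (i j : 'I_k -> nat),
    vars_in (fun v => if v is inr c then A c else True) phi ->
    {homo i : s t / s < t} -> {homo j : s t / s < t} ->
    let at_indices (h : 'I_k -> nat) v :=
      match v with inl q => a (h q.1) q.2 | inr c => c end in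
    sat (at_indices i) phi <-> sat (at_indices j) phi.

Definition divides n A (theta : pformula M n) : Prop :=
  exists m (phi : formula L ('I_n + 'I_m)) (a : 'I_m -> M),
    theta = inst phi a /\
    exists k (b : nat -> 'I_m -> M),
      (forall i, tp A (b i) = tp A a) /\
      k_inconsistent k (fun i => inst phi (b i)).

Definition forks n A (theta : pformula M n) : Prop :=
  exists D : set (pformula M n),
    [/\ finite_set D, D `<=` divides A &
        forall x, psat x theta -> exists2 psi, D psi & psat x psi].

Definition implies n (p : set (pformula M n)) (theta : pformula M n) : Prop :=
  exists F : set (pformula M n),
    [/\ finite_set F, F `<=` p &
        forall x, (forall psi, F psi -> psat x psi) -> psat x theta].

Definition type_forks n A (p : set (pformula M n)) : Prop :=
  exists2 theta, implies p theta & forks A theta.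

Definition TP2 n m (phi : formula L ('I_n + 'I_m)) : Prop :=
  exists (a : nat -> nat -> 'I_m -> M) k,
    (forall i, k_inconsistent k (fun j => inst phi (a i j))) /\
    (forall f : nat -> nat, consistent (range (fun i => inst phi (a i (f i))))).

Definition NTP2 : Prop :=
  forall n m (phi : formula L ('I_n + 'I_m)), ~ TP2 phi.

Definition extension_base C : Prop :=
  forall n (p : set (pformula M n)), complete_types C p -> ~ type_forks C p.

Definition chain_condition A : Prop :=
  forall n m (phi : formula L ('I_n + 'I_m)) (a : nat -> 'I_m -> M),
    indiscernible A a -> ~ forks A (inst phi (a 0)) ->
    ~ forks A (And (inst phi (a 0)) (inst phi (a 1))).

End Structure.

Arguments monster {L} M K T.
Arguments NTP2 {L} M.

(* Main.v *)
(* Let N be a small elementary submodel containing C whose type over the data does not divide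
   over C; as C is an extension base it exists, and it reduces everything to C = N.
   In an NTP2 theory a formula that divides over N divides along a sequence of coheirs over N.
   The broom lemma then shows that a forking formula has finitely many conjugates with
   inconsistent conjunction, and this provides strictly nonforking coheirs. Along sequences of
   these every formula that divides over N is inconsistent (Kim's lemma), so that forking equals
   dividing. Finally, if phi(x, a_0) /\ phi(x, a_1) divided over N, applying Kim's lemma to
   copies of the whole sequence (a_i) would give an array in which phi(x, a_0) yields TP2 for a
   finite conjunction of instances of phi, unless phi(x, a_0) divides as well. *)

Require Import Defs.
From Stdlib Require List.
From mathcomp Require Import all_boot.
From mathcomp Require Import boolp classical_sets functions cardinality filter.

Set Implicit Arguments.
Unset Strict Implicit.
Unset Printing Implicit Defensive.

Local Open Scope classical_set_scope.
Local Open Scope card_scope.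

(** Saturation is used only for countable tuples over small sets, while [N] may be uncountable.
    Hence [N] itself is never moved: the countable data are moved instead, by automorphisms over
    [C]. For the same reason there are no global nonforking types. They are replaced by
    [nondividing], which forbids single dividing formulas; finite disjunctions of these are dealt
    with by the extension base over [C] and by the broom lemma over [N]. Types are not sets of
    syntactic formulas but collections of [definable] predicates on tuples with arbitrary index
    types, and equality of types becomes conjugacy by automorphisms. In this form dividing depends
    only on the defined set and the base; formulas in the sense of the statement return at the
    end. *)

Definition sumf (X Y Z : Type) (f : X -> Z) (g : Y -> Z) (s : X + Y) : Z :=
  match s with inl x => f x | inr y => g y end.

Lemma sumf_comp X Y Z T (h : Z -> T) (f : X -> Z) (g : Y -> Z) :
  h \o sumf f g = sumf (h \o f) (h \o g).
Proof. by apply: funext => -[]. Qed.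

(** * Substitution and support of formulas *)

Section Syntax.
Context (L : language).

Lemma trename_vars V W (r : V -> W) (P : W -> Prop) (t : term L V) :
  tvars_in P (trename r t) <-> tvars_in (P \o r) t.
Proof.
elim: t => [//|f ts IH] /=.
by split=> H i; apply/IH/H.
Qed.

Lemma rename_vars V W (r : V -> W) (P : W -> Prop) (phi : formula L V) :
  vars_in P (rename r phi) <-> vars_in (P \o r) phi.
Proof.
elim: phi W r P => {V} /=.
- by move=> V t u W r P; rewrite !trename_vars.
- by move=> V s ts W r P; split=> H i; apply/trename_vars/H.
- by move=> V p IH W r P; apply: IH.
- by move=> V p IHp q IHq W r P; rewrite IHp IHq.
- move=> V p IH W r P; rewrite IH.
  by have -> : (fun o : option W => if o is Some v then P v else True) \o omap r
     = (fun o => if o is Some v then (P \o r) v else True)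
    by apply: funext => -[].
Qed.

Lemma tvars_inW V (P Q : V -> Prop) (t : term L V) :
  (forall v, P v -> Q v) -> tvars_in P t -> tvars_in Q t.
Proof. by move=> PQ; elim: t => [v|f ts IH] /=; [exact: PQ|move=> H i; exact/IH]. Qed.

Lemma vars_inW V (P Q : V -> Prop) (phi : formula L V) :
  (forall v, P v -> Q v) -> vars_in P phi -> vars_in Q phi.
Proof.
elim: phi P Q => {V} /=.
- by move=> V t u P Q PQ [tP uP]; split; apply: tvars_inW PQ _.
- by move=> V s ts P Q PQ H i; apply: tvars_inW PQ _.
- by move=> V p IH P Q PQ; apply: IH.
- by move=> V p IHp q IHq P Q PQ [pP qP]; split; [apply: IHp PQ _|apply: IHq PQ _].
- by move=> V p IH P Q PQ; apply: IH => -[].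
Qed.

Lemma tvars_inT V (P : V -> Prop) (t : term L V) :
  (forall v, P v) -> tvars_in P t.
Proof. by move=> PT; elim: t => //= f ts IH i. Qed.

Lemma vars_inT V (P : V -> Prop) (phi : formula L V) :
  (forall v, P v) -> vars_in P phi.
Proof.
elim: phi P => {V} /=.
- by move=> V t u P PT; split; apply: tvars_inT.
- by move=> V s ts P PT i; apply: tvars_inT.
- by move=> V p IH P PT; apply: IH.
- by move=> V p IHp q IHq P PT; split; [apply: IHp|apply: IHq].
- by move=> V p IH P PT; apply: IH => -[].
Qed.

Lemma tvars_in_and V (P Q : V -> Prop) (t : term L V) :
  tvars_in P t -> tvars_in Q t -> tvars_in (fun v => P v /\ Q v) t.
Proof. by elim: t => //= f ts IH HP HQ i; apply: IH. Qed.

Lemma vars_in_and V (P Q : V -> Prop) (phi : formula L V) :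
  vars_in P phi -> vars_in Q phi -> vars_in (fun v => P v /\ Q v) phi.
Proof.
elim: phi P Q => {V} /=.
- by move=> V t u P Q [? ?] [? ?]; split; apply: tvars_in_and.
- by move=> V s ts P Q HP HQ i; apply: tvars_in_and.
- by move=> V p IH P Q; apply: IH.
- by move=> V p IHp q IHq P Q [? ?] [? ?]; split; [apply: IHp|apply: IHq].
- move=> V p IH P Q HP HQ; apply: vars_inW (IH _ _ HP HQ).
  by case=> [v|].
Qed.

Lemma In_flatten_enum n V (g : 'I_n -> seq V) (i : 'I_n) (v : V) :
  List.In v (g i) -> List.In v (flatten [seq g j | j <- enum 'I_n]).
Proof.
move=> vg; have : i \in enum 'I_n by rewrite mem_enum.
elim: (enum _) => //= j js IH; rewrite inE => /orP[/eqP <-|/IH H];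
  apply/List.in_app_iff; by [left|right].
Qed.

Lemma tvars_in_finite V (t : term L V) :
  exists s : seq V, tvars_in (fun v => List.In v s) t.
Proof.
elim: t => [v|f ts /choice[g gP]] /=; first by exists [:: v]; left.
exists (flatten [seq g i | i <- enum 'I_(far f)]) => i.
apply: tvars_inW (gP i) => v vg.
exact: In_flatten_enum vg.
Qed.

Lemma vars_in_finite V (phi : formula L V) :
  exists s : seq V, vars_in (fun v => List.In v s) phi.
Proof.
elim: phi => {V} /=.
- move=> V t u; have [s1 H1] := tvars_in_finite t; have [s2 H2] := tvars_in_finite u.
  exists (s1 ++ s2); split.
    by apply: tvars_inW H1 => v Hv; apply/List.in_app_iff; left.
  by apply: tvars_inW H2 => v Hv; apply/List.in_app_iff; right.
- move=> V s ts.
  have /choice[g gP] : forall i, exists s, tvars_in (fun v => List.In v s) (ts i).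
    by move=> i; apply: tvars_in_finite.
  exists (flatten [seq g i | i <- enum 'I_(rar s)]) => i.
  apply: tvars_inW (gP i) => v vg.
  exact: In_flatten_enum vg.
- by [].
- move=> V p [s1 H1] q [s2 H2].
  exists (s1 ++ s2); split.
    by apply: vars_inW H1 => v Hv; apply/List.in_app_iff; left.
  by apply: vars_inW H2 => v Hv; apply/List.in_app_iff; right.
- move=> V p [s H]; exists (pmap id s); apply: vars_inW H => -[v|//].
  by elim: s => //= -[w|] s IH /= [//|/IH //]; [case=> ->; left|right].
Qed.

(** Only finitely many variables occur in a formula: [r] sends them to a finite index set and [g]
    finds them back. Renaming along [r] thus turns a formula in arbitrary variables into one in
    finitely many. *)
Variant supported V (phi : formula L V) : Prop :=
  Supported q (r : V -> 'I_q.+1) (g : 'I_q.+1 -> option V) of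
    vars_in (fun v => g (r v) = Some v) phi.

Lemma formula_supportP V (phi : formula L V) : supported phi.
Proof.
have [s Hs] := vars_in_finite phi.
pose s' : seq {classic V} := s.
have inP v : List.In v s -> (v : {classic V}) \in s'.
  rewrite /s'; elim: s {Hs s'} => //= w s IH [->|/IH H]; rewrite inE ?eqxx //.
  by rewrite H orbT.
(* The last index, [size s], collects the variables outside [s]; there [g] is [None]. *)
apply: (@Supported _ _ (size s) (fun v => inord (index (v : {classic V}) s'))
  (fun i => ohead (drop i s))).
apply: vars_inW Hs => v /inP vs.
have ltv : index (v : {classic V}) s' < size s by rewrite index_mem.
rewrite inordK; last exact: ltnW.
by rewrite (drop_nth (v : {classic V})) //= (nth_index (v : {classic V}) vs).
Qed.

Context (M : structure L).

Lemma teval_rename V W (r : V -> W) (v : W -> M) (t : term L V) :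
  teval v (trename r t) = teval (v \o r) t.
Proof. by elim: t => [//|f ts IH] /=; congr fint; apply: funext. Qed.

Lemma sat_eqfun V (v w : V -> M) (phi : formula L V) :
  v =1 w -> sat v phi -> sat w phi.
Proof. by move=> /funext ->. Qed.

Lemma sat_rename V W (r : V -> W) (v : W -> M) (phi : formula L V) :
  sat v (rename r phi) <-> sat (v \o r) phi.
Proof.
elim: phi W r v => {V} /=.
- by move=> V t u W r v; rewrite !teval_rename.
- move=> V s ts W r v.
  by under eq_fun do rewrite teval_rename.
- by move=> V p IH W r v; rewrite IH.
- by move=> V p IHp q IHq W r v; rewrite IHp IHq.
- move=> V p IH W r v; split=> -[m]; rewrite ?IH => H; exists m; rewrite ?IH;
  by apply: sat_eqfun H => -[].
Qed.

Lemma teval_ext V (P : V -> Prop) (v w : V -> M) (t : term L V) :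
  (forall x, P x -> v x = w x) -> tvars_in P t -> teval v t = teval w t.
Proof.
move=> vw; elim: t => [x|f ts IH] /=; first exact: vw.
by move=> H; congr fint; apply: funext => i; apply: IH.
Qed.

Lemma sat_ext V (P : V -> Prop) (v w : V -> M) (phi : formula L V) :
  (forall x, P x -> v x = w x) -> vars_in P phi -> sat v phi <-> sat w phi.
Proof.
elim: phi P v w => {V} /=.
- by move=> V t u P v w vw [tP uP]; rewrite !(teval_ext vw).
- move=> V s ts P v w vw H.
  by have -> : (fun i => teval v (ts i)) = (fun i => teval w (ts i))
    by apply: funext => i; apply: teval_ext vw _.
- by move=> V p IH P v w vw H; rewrite (IH _ _ _ vw H).
- by move=> V p IHp q IHq P v w vw [Hp Hq]; rewrite (IHp _ _ _ vw Hp) (IHq _ _ _ vw Hq).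
- move=> V p IH P v w vw H; split=> -[m Hm]; exists m; move: Hm;
  by apply: (iffLR (IH _ _ _ _ H)) => -[x /vw|//].
Qed.

Lemma automorphism_teval (f : M -> M) : automorphism f ->
  forall V (v : V -> M) (t : term L V), teval (f \o v) t = f (teval v t).
Proof.
case=> _ fF _ V v; elim=> [//|s ts IH] /=; rewrite fF; congr fint.
exact: funext.
Qed.

Lemma automorphism_sat (f : M -> M) : automorphism f ->
  forall V (phi : formula L V) (v : V -> M), sat (f \o v) phi <-> sat v phi.
Proof.
move=> fA V phi; elim: phi => {V} /=.
- move=> V t u v; rewrite !automorphism_teval //; split=> [|-> //].
  by case: fA => /bij_inj fI _ _ /fI.
- move=> V s ts v; case: (fA) => _ _ fR.
  have -> : (fun i => teval (f \o v) (ts i)) = f \o (fun i => teval v (ts i)).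
    by apply: funext => i; apply: automorphism_teval.
  by rewrite -fR.
- by move=> V p IH v; rewrite IH.
- by move=> V p IHp q IHq v; rewrite IHp IHq.
- move=> V p IH v; case: (fA) => -[g fK gK] _ _; split=> -[m Hm].
  + by exists (g m); rewrite -IH; apply: sat_eqfun Hm => -[//|] /=; rewrite gK.
  + by exists (f m); rewrite -IH in Hm; apply: sat_eqfun Hm => -[].
Qed.

End Syntax.

(** * Definable relations *)

Section Definability.
Context (L : language) (M : structure L).

(** [Ex] binds one variable at a time, so the block is quantified by induction, [ord0] becoming the
    bound variable [None]. The clause on [P] records that no parameter is added. *)
Lemma ex_formula V q (theta : formula L (V + 'I_q)) :
  exists theta' : formula L V,
    (forall P, vars_in (sumf P (fun=> True)) theta -> vars_in P theta') /\
    forall v : V -> M, sat v theta' <-> exists z, sat (sumf v z) theta.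
Proof.
elim: q V theta => [|q IH] V theta.
  have [r rE] : exists r : V + 'I_0 -> V, forall v, r (inl v) = v.
    by unshelve eexists; [case=> [v|[]//]; exact: v|].
  have rE' (v : V -> M) z : v \o r = sumf v z.
    by apply: funext => -[w|[]//] /=; rewrite rE.
  exists (rename r theta); split=> [P|v].
    by move=> H; apply/rename_vars; apply: vars_inW H => -[v|[]//] /=; rewrite rE.
  rewrite sat_rename; split=> [|[z]]; last by rewrite (rE' _ z).
  have z : 'I_0 -> M by case.
  by rewrite (rE' _ z); exists z.
pose r (s : V + 'I_q.+1) : option V + 'I_q :=
  match s with
  | inl v => inl (Some v)
  | inr i => if unlift ord0 i is Some j then inr j else inl None
  end.
have [theta' [H1 H2]] := IH _ (rename r theta).
exists (Ex theta'); split=> [P H|v] /=.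
  apply: H1; apply/rename_vars; apply: vars_inW H => -[//|i] /= _.
  by case: unliftP.
split=> [[m /H2 [z]]|[z H]].
  rewrite sat_rename => H.
  exists (fun i => if unlift ord0 i is Some j then z j else m).
  by apply: sat_eqfun H => -[//|i] /=; case: unliftP.
exists (z ord0); apply/H2; exists (fun j => z (lift ord0 j)).
rewrite sat_rename; apply: sat_eqfun H => -[//|i] /=.
by case: unliftP => [j|] ->.
Qed.

(* Types and parameters are handled through the relations [P] on [V]-indexed tuples
   that are definable over [A]; [V] may be infinite. *)
Definition definable (A : set M) V (P : (V -> M) -> Prop) :=
  exists theta : formula L (V + M), vars_in (sumf (fun=> True) A) theta /\
    forall v, P v <-> sat (sumf v id) theta.

Implicit Types (A B D : set M) (V W Z : Type).

Lemma definable_iff A V (P Q : (V -> M) -> Prop) :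
  (forall v, P v <-> Q v) -> definable A Q -> definable A P.
Proof. by move=> PQ [t [tA tQ]]; exists t; split=> // v; rewrite PQ. Qed.

Lemma definable_sub A B V (P : (V -> M) -> Prop) : A `<=` B -> definable A P -> definable B P.
Proof.
move=> AB [t [tA tP]]; exists t; split=> //; apply: vars_inW tA => -[//|c].
exact: AB.
Qed.

Lemma definable_subst A V W (r : V -> W + M) (P : (V -> M) -> Prop) :
  (forall v c, r v = inr c -> A c) ->
  definable A P -> definable A (fun w => P (fun v => sumf w id (r v))).
Proof.
move=> rA [t [tA tP]].
exists (rename (fun s => match s with inl v => r v | inr c => inr c end) t).
split=> [|w].
  apply/rename_vars; apply: vars_inW tA => -[v _|//] /=.
  by case E: (r v) => //=; apply: rA E.
rewrite tP sat_rename; split; by apply: sat_eqfun => -[].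
Qed.

Lemma definable_reindex A V W (r : V -> W) (P : (V -> M) -> Prop) :
  definable A P -> definable A (fun w => P (w \o r)).
Proof. by apply: (@definable_subst A V W (fun v => inl (r v))). Qed.

Lemma definable_not A V (P : (V -> M) -> Prop) : definable A P -> definable A (fun v => ~ P v).
Proof. by move=> [t [tA tP]]; exists (Not t); split=> // v; rewrite tP. Qed.

Lemma definable_and A V (P Q : (V -> M) -> Prop) :
  definable A P -> definable A Q -> definable A (fun v => P v /\ Q v).
Proof.
move=> [t [tA tP]] [u [uA uQ]]; exists (And t u); split=> // v.
by rewrite tP uQ.
Qed.

Lemma definable_or A V (P Q : (V -> M) -> Prop) :
  definable A P -> definable A Q -> definable A (fun v => P v \/ Q v).
Proof.
move=> hP hQ; apply: (@definable_iff _ _ _ (fun v => ~ (~ P v /\ ~ Q v))).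
  move=> v; split=> [[p [np _]|q [_ nq]]|/not_andP[] /contrapT] //; by [left|right].
by apply/definable_not/definable_and; apply: definable_not.
Qed.

Lemma definable_imp A V (P Q : (V -> M) -> Prop) :
  definable A P -> definable A Q -> definable A (fun v => P v -> Q v).
Proof.
move=> hP hQ; apply: (@definable_iff _ _ _ (fun v => ~ P v \/ Q v)).
  by move=> v; split=> [pq|[/[apply]|q _]] //; case: (pselect (P v)) => [/pq|]; by [right|left].
by apply: definable_or => //; apply: definable_not.
Qed.


(** The main tool for definability: it allows predicates to be handled semantically, the renaming of
    variables and the insertion of parameters being done coordinate by coordinate. *)
Lemma definable_coord A V W (F : (V -> M) -> W -> M) (P : (W -> M) -> Prop) :
  (forall w, (exists x, forall v, F v w = v x) \/
             (exists2 c, A c & forall v, F v w = c)) ->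
  definable A P -> definable A (fun v => P (F v)).
Proof.
move=> FP hP.
have /choice[r rP] : forall w, exists s : V + M,
    (forall v, F v w = sumf v id s) /\ (forall c, s = inr c -> A c).
  move=> w; case: (FP w) => [[x xP]|[c Ac cP]].
    by exists (inl x).
  by exists (inr c); split=> // d [<-].
apply: definable_iff (definable_subst (r := r) (fun w c => (rP w).2 c) hP) => v.
by have -> : F v = (fun w => sumf v id (r w)) by apply: funext => w; rewrite (rP w).1.
Qed.

Lemma definable_true A V : definable A (fun _ : V -> M => True).
Proof.
have [m] := Defs.nonempty M.
exists (Ex (Eq (Var L None) (Var L None))); split=> // v; split=> // _.
by exists m.
Qed.

Lemma definable_false A V : definable A (fun _ : V -> M => False).
Proof.
by apply: (definable_iff _ (definable_not (@definable_true A V))) => v; split=> // /(_ I).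
Qed.

Lemma definable_eq A V (x y : V) : definable A (fun v : V -> M => v x = v y).
Proof. by exists (Eq (Var L (inl x)) (Var L (inl y))). Qed.

Lemma definable_eqc A V (x : V) (c : M) : A c -> definable A (fun v : V -> M => v x = c).
Proof. by move=> Ac; exists (Eq (Var L (inl x)) (Var L (inr c))). Qed.

Lemma definable_all_In A V I (s : seq I) (P : I -> (V -> M) -> Prop) :
  (forall i, List.In i s -> definable A (P i)) ->
  definable A (fun v => forall i, List.In i s -> P i v).
Proof.
elim: s => [|i s IH] H; first by apply: definable_iff (definable_true A V) => v; split.
have hi := H i (or_introl erefl).
have hs := IH (fun j js => H j (or_intror js)).
apply: definable_iff (definable_and hi hs) => v; split=> [h|[h1 h2] j [<-|/h2]//].
by split=> [|j js]; apply: h; [left|right].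
Qed.

Lemma definable_all_fin A V (I : finType) (P : I -> (V -> M) -> Prop) :
  (forall i, definable A (P i)) -> definable A (fun v => forall i, P i v).
Proof.
move=> H; apply: (@definable_iff _ _ _ (fun v => forall i, List.In i (enum I) -> P i v)).
  move=> v; split=> h i; first by move=> _; apply: h.
  apply: h; have : i \in enum I by rewrite mem_enum.
  by elim: (enum I) => //= j s IH; rewrite inE => /orP[/eqP->|/IH]; [left|right].
by apply: definable_all_In => i _; apply: H.
Qed.

Lemma definable_andb A V (c : bool) (P : (V -> M) -> Prop) :
  (c -> definable A P) -> definable A (fun v => c /\ P v).
Proof.
case: c => h; first by apply: definable_iff (h isT) => v; split=> [[]|].
by apply: definable_iff (@definable_false A V) => v; split=> [[]|].
Qed.

Lemma definable_forall_lt A V n (P : nat -> (V -> M) -> Prop) :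
  (forall i, i < n -> definable A (P i)) -> definable A (fun v => forall i, i < n -> P i v).
Proof.
elim: n => [|n IH] H; first by apply: definable_iff (definable_true A V) => v; split.
apply: definable_iff (definable_and (IH (fun i lt => H i (ltnW lt))) (H n (ltnSn n))) => v.
split=> [h|[h1 h2] i]; first by split=> [i lt|]; apply: h => //; exact: ltnW.
by rewrite ltnS leq_eqVlt => /orP[/eqP -> //|]; apply: h1.
Qed.

Lemma definable_exists_lt A V n (P : nat -> (V -> M) -> Prop) :
  (forall i, i < n -> definable A (P i)) ->
  definable A (fun v => exists2 i, i < n & P i v).
Proof.
move=> H.
have nH := definable_forall_lt (fun i lt => definable_not (H i lt)).
apply: definable_iff (definable_not nH).
move=> v; split=> [[i lt h] /(_ i lt)//|/existsNP[i /not_implyP[lt /contrapT h]]].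
by exists i.
Qed.

(** [Z] may be infinite: only the finitely many variables that occur are quantified, and values for
    these extend to all of [Z] through [r]. *)
Lemma definable_ex A V Z (P : (V + Z -> M) -> Prop) :
  definable A P -> definable A (fun v => exists z, P (sumf v z)).
Proof.
move=> [t [tA tP]]; have [q r g supp] := formula_supportP t.
pose rho (s : (V + Z) + M) : (V + M) + 'I_q.+1 :=
  match s with
  | inl (inl v) => inl (inl v)
  | inl (inr z) => inr (r s)
  | inr c => inl (inr c)
  end.
have [t' [t'A t'P]] := ex_formula (rename rho t).
exists t'; split=> [|v].
  by apply/t'A/rename_vars; apply: vars_inW tA => -[[]|].
rewrite t'P; split=> [[z /tP h]|[y]].
  have [m] := Defs.nonempty M.
  exists (fun i => if g i is Some s then sumf (sumf v z) id s else m).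
  rewrite sat_rename; apply: (iffLR (sat_ext _ supp)) h => -[[//|x]|//].
  by rewrite /= => ->.
rewrite sat_rename => h.
exists (fun x => y (r (inl (inr x)))); apply/tP.
by apply: sat_eqfun h => -[[]|].
Qed.

Lemma definable_all A V Z (P : (V + Z -> M) -> Prop) :
  definable A P -> definable A (fun v => forall z, P (sumf v z)).
Proof.
move=> h; apply: (definable_iff _ (definable_not (definable_ex (definable_not h)))) => v.
by split=> [H [z]//|/forallNP H z]; apply: contrapT.
Qed.

Lemma definable_supp A V (P : (V -> M) -> Prop) :
  definable A P -> exists s : seq V, forall v w : V -> M,
    (forall x, List.In x s -> v x = w x) -> P v <-> P w.
Proof.
move=> [t [_ tP]]; have [s sP] := vars_in_finite t.
exists (pmap (fun x => if x is inl y then Some y else None) s) => v w vw.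
rewrite !tP; apply: sat_ext sP => -[x|//] /= xs; apply: vw.
elim: s xs {t tP} => //= y s IH [->|/IH h]; first by left.
by case: y => // y; right.
Qed.

Lemma In_bound V (f : V -> nat) (s : seq V) :
  exists n, forall x, List.In x s -> f x < n.
Proof.
elim: s => [|x s [n IH]]; first by exists 0.
exists (maxn (f x).+1 n) => y /= [<-|/IH lt]; rewrite leq_max ?ltnSn //.
by rewrite lt orbT.
Qed.

Lemma definable_finsupp A V (f : V -> nat) (P : (V -> M) -> Prop) :
  definable A P -> exists n, forall v w : V -> M,
    (forall x, f x < n -> v x = w x) -> P v <-> P w.
Proof.
move=> /definable_supp[s sP]; have [n nP] := In_bound f s.
by exists n => v w vw; apply: sP => x /nP /vw.
Qed.

(** A formula has finitely many parameters; those in [D] become the tuple [e], even if they also lie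
    in [A]. *)
Lemma definable_split A D V (P : (V -> M) -> Prop) : definable (A `|` D) P ->
  exists k (e : 'I_k -> M) (Q : ('I_k + V -> M) -> Prop),
    [/\ forall i, D (e i), definable A Q & forall v, P v <-> Q (sumf e v)].
Proof.
move=> [t [tA tP]]; have [s sP] := vars_in_finite t.
pose isD (x : V + M) : option {classic M} :=
  if x is inr c then if `[< D c >] then Some c else None else None.
pose sD : seq {classic M} := pmap isD s.
exists (size sD), (fun i => tnth (in_tuple sD) i).
have sDD c : c \in sD -> D c.
  rewrite /sD; elim: {sP} (s) => //= -[v|d] s' IH //=.
  by case: asboolP => //= Dd; rewrite inE => /orP[/eqP ->|].
have Ds c : List.In (inr c) s -> D c -> (c : {classic M}) \in sD.
  move=> + Dc; rewrite /sD; elim: (s) => //= -[v|d] s' IH /= [//|].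
  - by move=> /IH.
  - by case=> ->; rewrite asboolT //= inE eqxx.
  - by move=> /IH; case: asboolP => //= _; rewrite inE => ->; rewrite orbT.
pose rho (x : V + M) : ('I_(size sD) + V) + M :=
  match x with
  | inl v => inl (inr v)
  | inr c => if insub (index (c : {classic M}) sD) is Some i then inl (inl i)
             else inr c
  end.
exists (fun v => sat (sumf v id) (rename rho t)); split=> [i||v].
- by apply: sDD; exact: mem_tnth.
- exists (rename rho t); split=> //; apply/rename_vars.
  apply: vars_inW (vars_in_and sP tA) => -[v|c] //= [cs AD].
  case: insubP => //= /negP nlt; case: AD => // /(Ds c cs).
  by rewrite -index_mem => /nlt.
- rewrite tP sat_rename; apply: sat_ext sP => -[w|c] //= cs.
  case: insubP => //= i _ iE; rewrite (tnth_nth (c : {classic M})) /= iE.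
  by rewrite nth_index // -index_mem -iE.
Qed.

End Definability.

(** * Saturation for countable tuples *)

Definition satisfies T (s : seq (T -> Prop)) (x : T) :=
  forall P, List.In P s -> P x.

(** A partial type is a set of predicates; its finite parts are lists under [List.In], which needs
    no decidable equality. *)
Definition finitely_sat T (F : (T -> Prop) -> Prop) :=
  forall s, (forall P, List.In P s -> F P) -> exists x, satisfies s x.

Lemma satisfies_cat T (s1 s2 : seq (T -> Prop)) x :
  satisfies (s1 ++ s2) x <-> satisfies s1 x /\ satisfies s2 x.
Proof.
split=> [H|[H1 H2] P /List.in_app_iff[/H1|/H2]//].
by split=> P Ps; apply: H; apply/List.in_app_iff; [left|right].
Qed.

Lemma finite_set_In T (F : set T) : finite_set F ->
  exists s, F = [set x | List.In x s].
Proof.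
move=> /(@finite_seqP {classic T})[s sE]; exists s; rewrite sE.
apply/seteqP; split=> x /=; elim: (s) => //= y s' IH.
  by rewrite inE => /orP[/eqP->|/IH]; [left|right].
by rewrite inE => -[->|/IH ->]; rewrite ?eqxx ?orbT.
Qed.

Lemma finite_In T (s : seq T) : finite_set [set x | List.In x s].
Proof.
elim: s => [|y s IH] /=; first by apply: sub_finite_set (finite_set0 T).
have -> : [set x | y = x \/ List.In x s] = y |` [set x | List.In x s].
  by apply/seteqP; split=> x /= [->|?]; [left|right|left|right].
by rewrite finite_setU; split=> //; apply: finite_set1.
Qed.

Section Saturation.
Context (L : language) (M : structure L) (K : Type).
Hypothesis sat_M : saturated M K.
Hypothesis small_countable :
  forall A B : set M, small K A -> countable B -> small K (A `|` B).

Implicit Types (A B D : set M).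

(** Saturation speaks of complete types. An ultrafilter containing the solution sets of all finite
    parts of [F] supplies a completion. *)
Lemma realize1 A (F : (('I_1 -> M) -> Prop) -> Prop) : small K A ->
  (forall P, F P -> definable A P) -> finitely_sat F ->
  exists x, forall P, F P -> P x.
Proof.
move=> sA FD FS.
pose G0 : set_system ('I_1 -> M) := [set X | exists s,
  (forall P, List.In P s -> F P) /\ forall x, satisfies s x -> X x].
have G0F : ProperFilter G0.
  split.
    by move=> [s [/FS [x xs]]] /(_ x xs).
  split.
  - by exists nil.
  - move=> X Y [s [sF sX]] [t [tF tY]]; exists (s ++ t); split.
      by move=> P /List.in_app_iff [/sF|/tF].
    by move=> x /satisfies_cat [/sX ? /tY].
  - by move=> X Y XY [s [sF sX]]; exists s; split=> // x /sX /XY.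
have [G [GU G0G]] := ultraFilterLemma G0F.
pose p : set (pformula M 1) := [set theta | Defs.over A theta /\ G [set x | psat x theta]].
have [|x xp] := sat_M sA (p := p).
  split=> [theta []//|F' finF F'p|theta oth].
    have [s sE] := finite_set_In finF; subst F'.
    have : G [set x | forall theta, List.In theta s -> psat x theta].
      elim: s F'p {finF} => [|t s IH] F'p.
        by apply: (filterS (P := setT)); [move=> ? _ ? []|exact: filterT].
      have [_ Gt] := F'p t (or_introl erefl).
      apply: filterS (filterI Gt (IH _)) => [x [xt xs] u /= [<-//|/xs//]|u us].
      by apply: F'p; right.
    by move=> /filter_ex.
  have [Gt|Gt] := in_ultra_setVsetC [set x | psat x theta] GU; first by left.
  by right.
exists x => P FP; have [t [tA tP]] := FD P FP.
apply/tP; apply: (xp t); split; first by apply: vars_inW tA => -[].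
apply: G0G; exists [:: P]; split=> [Q /= [<-//|//]|y].
by move=> /(_ P (or_introl erefl)) /tP.
Qed.

(* The coordinates are chosen one at a time: the requirement on the next one is the 1-type,
   over [A] and the coordinates already chosen, saying that the rest can be completed. *)
Lemma realize_nat A (F : ((nat -> M) -> Prop) -> Prop) : small K A ->
  (forall P, F P -> definable A P) -> finitely_sat F ->
  exists x, forall P, F P -> P x.
Proof.
move=> sA FD FS; have [m0] := Defs.nonempty M.
pose ext (s : seq M) (x : nat -> M) := forall i, i < size s -> x i = nth m0 s i.
pose ok (s : seq M) := forall t, (forall P, List.In P t -> F P) ->
  exists2 x, ext s x & satisfies t x.
have ok0 : ok nil by move=> t /FS [x]; exists x.
have okS s : exists m, ok s -> ok (rcons s m).
  have [oks|?] := pselect (ok s); last by exists m0.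
  pose F1 (Q : ('I_1 -> M) -> Prop) := exists2 t, (forall P, List.In P t -> F P) &
    Q = (fun y => exists x : nat -> M,
           ext s x /\ x (size s) = y ord0 /\ satisfies t x).
  have sAs : small K (A `|` [set c | List.In c s]).
    by apply: small_countable => //; apply/finite_set_countable/finite_In.
  have [||y yP] := realize1 sAs (F := F1).
  - move=> _ [t tF ->].
    apply: (@definable_ex _ _ _ _ nat (fun v => ext s (v \o inr) /\
       v (inr (size s)) = v (inl ord0) /\ satisfies t (v \o inr))).
    apply: definable_and; last apply: definable_and.
    + apply: definable_forall_lt => i ilt; apply: definable_eqc; right => /=.
      elim: s i ilt {oks F1 sAs} => //= c s IH [|i]; [by left|by move=> /IH; right].
    + exact: definable_eq.
    + apply: definable_all_In => P /tF /FD PD.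
      by apply: definable_sub (definable_reindex inr PD); apply: subsetUl.
  - move=> qs qsF1.
    have [t tF tqs] : exists2 t, (forall P, List.In P t -> F P) & forall x y,
        ext s x -> x (size s) = y (ord0 : 'I_1) -> satisfies t x -> satisfies qs y.
      elim: qs qsF1 => [|Q qs IH] qsF1; first by exists nil => [//|x y _ _ _ P []].
      have [|t tF tP] := IH; first by move=> P Pq; apply: qsF1; right.
      have [u uF uP] := qsF1 Q (or_introl erefl).
      exists (u ++ t) => [P /List.in_app_iff[/uF|/tF]//|x y xs xy].
      move=> /satisfies_cat [xu xt] R /= [<-|]; first by rewrite uP; exists x.
      exact: tP xs xy xt R.
    by have [x xs xt] := oks t tF; exists (fun=> x (size s)); apply: tqs xt.
  exists (y ord0) => _ t tF.
  have [x [xs [xy xt]]] := yP _ (ex_intro2 _ _ t tF erefl).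
  exists x => // i; rewrite size_rcons ltnS leq_eqVlt nth_rcons.
  by case: ltngtP => //= [/xs//|->].
have [next nextP] := choice okS.
pose S n := iter n (fun s => rcons s (next s)) nil.
have sizeS n : size (S n) = n by elim: n => //= n IH; rewrite size_rcons IH.
have okn n : ok (S n) by elim: n => //= n IH; apply: nextP.
have nthS n i : i < n -> nth m0 (S n) i = next (S i).
  elim: n => //= n IH; rewrite ltnS nth_rcons sizeS leq_eqVlt.
  by case: ltngtP => //= [/IH//|->].
exists (fun i => next (S i)) => P FP.
have [n nP] := definable_finsupp id (FD P FP).
have [|x xn xP] := okn n [:: P]; first by move=> Q /= [<-|].
apply: (iffLR (nP x _ _)) (xP P (or_introl erefl)) => i lti.
by rewrite xn ?sizeS // nthS.
Qed.

Lemma realize A (V : countType) (F : ((V -> M) -> Prop) -> Prop) : small K A ->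
  (forall P, F P -> definable A P) -> finitely_sat F ->
  exists x, forall P, F P -> P x.
Proof.
move=> sA FD FS; have [m0] := Defs.nonempty M.
have [||x xP] := realize_nat sA
    (F := fun Q => exists2 P, F P & Q = (fun x => P (x \o pickle))).
- by move=> _ [P FP ->]; apply: definable_reindex (FD P FP).
- move=> qs qsF.
  have [t tF tqs] : exists2 t, (forall P, List.In P t -> F P) & forall x,
        satisfies t (x \o pickle) -> satisfies qs x.
    elim: qs qsF => [|Q qs IH] qsF; first by exists nil => [//|x _ P []].
    have [|t tF tP] := IH; first by move=> P Pq; apply: qsF; right.
    have [P FP PQ] := qsF Q (or_introl erefl).
    exists (P :: t) => [R /= [<-|/tF]//|x xPt R /= [<-|Rqs]].
      by rewrite PQ; apply: xPt; left.
    by apply: tP Rqs => S St; apply: xPt; right.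
  have [x xt] := FS t tF.
  exists (fun n => if unpickle n is Some v then x v else m0); apply: tqs.
  by congr satisfies : xt; apply: funext => v /=; rewrite pickleK.
by exists (x \o pickle) => P FP; apply: (xP (fun x => P (x \o pickle))); exists P.
Qed.

End Saturation.

(** * Automorphisms and types *)

Section Automorphisms.
Context (L : language) (M : structure L).
Implicit Types (A B D E F N : set M).

Definition aut A (s : M -> M) := automorphism s /\ forall x, A x -> s x = x.

Definition same_type A V (a a' : V -> M) := forall P, definable A P -> P a -> P a'.

Lemma aut_id A : aut A id.
Proof. by split=> //; split=> //; exists id. Qed.

Lemma aut_comp A s t : aut A s -> aut A t -> aut A (s \o t).
Proof.
move=> [[sb sF sR] sA] [[tb tF tR] tA]; split; last by move=> x Ax /=; rewrite tA ?sA.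
by split=> [|f a|r a]; [exact: bij_comp|rewrite /= tF sF|rewrite tR sR].
Qed.

Lemma aut_sub A B s : A `<=` B -> aut B s -> aut A s.
Proof. by move=> AB [sa sB]; split=> // x /AB /sB. Qed.

Lemma aut_inv A s : aut A s -> exists t, [/\ aut A t, cancel s t & cancel t s].
Proof.
move=> [[[t sK tK] sF sR] sA]; exists t; split=> //.
split; last by move=> x Ax; rewrite -{1}(sA x Ax) sK.
split=> [|f a|r a]; first by exists s.
  apply: (can_inj sK); rewrite tK sF; congr fint.
  by apply: funext => i /=; rewrite tK.
rewrite (sR r (t \o a)).
by have -> : s \o (t \o a) = a by apply: funext => i /=; rewrite tK.
Qed.

Lemma aut_definable A V (P : (V -> M) -> Prop) s v :
  aut A s -> definable A P -> P (s \o v) <-> P v.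
Proof.
move=> [sa sA] [t [tA tP]]; rewrite !tP -(automorphism_sat sa t (sumf v id)).
by apply: sat_ext tA => -[//|c] /= /sA ->.
Qed.

Lemma definable_conj A V (P : (V -> M) -> Prop) s :
  automorphism s -> definable (s @` A) P -> definable A (fun v => P (s \o v)).
Proof.
move=> sa [t [tA tP]].
have [u [_ sK uK]] := @aut_inv set0 s (conj sa (fun x (h : set0 x) => match h with end)).
exists (rename (fun x => match x with inl v => inl v | inr c => inr (u c) end) t).
split=> [|v].
  apply/rename_vars; apply: vars_inW tA => -[//|c] /= [x Ax <-].
  by rewrite sK.
rewrite tP sat_rename -(automorphism_sat sa _ (_ \o _)).
by split; apply: sat_eqfun => -[] //= c; rewrite uK.
Qed.

Lemma same_type_sym A V (a b : V -> M) : same_type A a b -> same_type A b a.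
Proof. by move=> ab P PD Pb; apply: contrapT => /(ab _ (definable_not PD)). Qed.

Lemma aut_same_type A V (a : V -> M) s : aut A s -> same_type A a (s \o a).
Proof. by move=> sA P PD /(aut_definable _ sA PD). Qed.

Lemma definable_sat A V (phi : formula L V) : definable A (fun v : V -> M => sat v phi).
Proof.
exists (rename inl phi); split; last by move=> v; rewrite sat_rename.
by apply/rename_vars/vars_inT.
Qed.

Context (K : Type).
Hypothesis hom_M : strongly_homogeneous M K.
Hypothesis small_countable :
  forall A B : set M, small K A -> countable B -> small K (A `|` B).

(** The map that fixes [A] and sends [a w] to [b w] is elementary, so strong homogeneity extends it.
    The preimages chosen in [f] do not matter, because the type contains the equations among the
    coordinates and with elements of [A]. *)
Lemma homogeneity A (W : countType) (a b : W -> M) : small K A -> same_type A a b ->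
  exists2 s, aut A s & s \o a = b.
Proof.
move=> sA ab.
pose f x := match pselect (A x) with left _ => x | right _ =>
   match pselect (exists w, a w = x) with
   | left h => b (projT1 (cid h)) | right _ => x end end.
have sAa : small K (A `|` range a).
  by apply: small_countable => //; apply: card_le_trans (card_image_le _ _) (countableP _).
have fP x : (A `|` range a) x -> exists s : W + M, 
    [/\ forall c, s = inr c -> A c, sumf a id s = x & sumf b id s = f x].
  rewrite /f; case: pselect => [Ax _|nAx [//|[w _ wx]]].
    by exists (inr x); split=> // c [<-].
  case: pselect => [h|[]]; last by exists w.
  by exists (inl (projT1 (cid h))); split=> //=; case: cid.
have [g [ga gA]] : exists g, automorphism g /\ forall x, (A `|` range a) x -> g x = f x.
  have [|g ga gP] := hom_M sAa (f := f); last by exists g.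
  move=> n phi e eA.
  have /choice[r rP] := fun i => fP (e i) (eA i).
  have D1 : definable A (fun v : W -> M => sat (fun i => sumf v id (r i)) phi).
    apply: (@definable_subst _ _ _ _ _ r _ _ (definable_sat A phi)) => i c.
    by case: (rP i) => /(_ c).
  have -> : e = (fun i => sumf a id (r i)) by apply: funext => i; case: (rP i).
  have -> : f \o (fun i => sumf a id (r i)) = (fun i => sumf b id (r i)).
    by apply: funext => i /=; case: (rP i) => _ -> ->.
  by split; [apply: (ab _ D1)|apply: (same_type_sym ab D1)].
exists g.
  split=> // x Ax; rewrite gA; last by left.
  by rewrite /f; case: pselect.
apply: funext => w /=; rewrite gA; last by right; exists w.
have [|s [sA' s1 s2]] := fP (a w); first by right; exists w.
rewrite -s2; case: s {s2} sA' s1 => [w'|c] sA' /= e.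
  have D1 : definable A (fun v : W -> M => v w' = v w) := definable_eq A w' w.
  exact: (ab _ D1).
have D1 : definable A (fun v : W -> M => v w = c) by apply/definable_eqc/sA'.
by rewrite (ab _ D1).
Qed.

End Automorphisms.

(** * Coheirs *)

Section Coheirs.
Context (L : language) (M : structure L) (N : set M).
Implicit Types (A B D E F : set M).

(* The type of the set [E] over [N] and [B] is finitely satisfiable in [N]. *)
Definition coheir E B := forall V (P : (V -> M) -> Prop) u,
  definable (N `|` B) P -> (forall v, E (u v)) -> P u ->
  exists2 u0, (forall v, N (u0 v)) & P u0.

(* Tarski-Vaught: every consistent formula over [N] is satisfied in [N]. *)
Definition elementary := coheir setT set0.

Lemma coheir_sub E E' B B' : E' `<=` E -> B' `<=` N `|` B -> coheir E B -> coheir E' B'.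
Proof.
move=> EE BB co V P u PD uE; apply: co => [|v]; last by apply/EE/uE.
by apply: definable_sub PD => x [Nx|/BB//]; left.
Qed.

Lemma coheir_set0 B : coheir set0 B.
Proof. by move=> V P u _ u0 Pu; exists u => // v; case: (u0 v). Qed.

(** The coordinates in [E] are moved into [N] while those in [F] serve as parameters; then the
    coordinates in [F] are moved. *)
Lemma coheir_trans E F B : coheir E (B `|` F) -> coheir F B -> coheir (E `|` F) B.
Proof.
move=> cE cF V P u PD uEF.
pose V1 := {v | E (u v)}; pose V2 := {v | ~ E (u v)}.
pose mrg (x : V1 -> M) (y : V2 -> M) v := match pselect (E (u v)) with
  left h => x (exist _ v h) | right h => y (exist _ v h) end.
have mrgu : mrg (u \o sval) (u \o sval) = u.
  by apply: funext => v; rewrite /mrg; case: pselect.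
rewrite -{1}mrgu => Pu.
have [|[]//|x0 x0N {}Pu] := cE V1 (fun x => P (mrg x (u \o sval))) (u \o sval) _ _ Pu.
  apply: definable_coord (definable_sub _ PD); last by move=> x [|]; [left|right; left].
  move=> v; rewrite /mrg; case: pselect => h; first by left; exists (exist _ v h).
  by right; exists (u v) => //; right; right; case: (uEF v).
have [||y0 y0N {}Pu] := cF V2 (fun y => P (mrg x0 y)) (u \o sval) _ _ Pu.
- apply: definable_coord PD => v; rewrite /mrg.
  case: pselect => h; last by left; exists (exist _ v h).
  by right; exists (x0 (exist _ v h)) => //; left.
- by move=> [v /= h]; case: (uEF v).
by exists (mrg x0 y0) => // v; rewrite /mrg; case: pselect.
Qed.

(** Coheirs are invariant over [N]: a formula over [E] separating [b] from [b'] would separate them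
    with parameters [e0] from [N]. *)
Lemma coheir_same_type E B V (b b' : V -> M) : coheir E B ->
  (forall v, B (b v)) -> (forall v, B (b' v)) -> same_type N b b' -> same_type (N `|` E) b b'.
Proof.
move=> co bB b'B bb' P /definable_split [k [e [Q [eE QD PQ]]]] Pb; apply: contrapT => nPb'.
have [|||e0 e0N [Qb nQb']] := co 'I_k
  (fun x => Q (sumf x b) /\ ~ Q (sumf x b')) e.
- apply: definable_and; last apply: definable_not.
    apply: (@definable_coord _ _ _ _ _ (fun x => sumf x b)) (definable_sub _ QD);
      last by move=> ?; left.
    by move=> [i|v]; [left; exists i|right; exists (b v) => //; right].
  apply: (@definable_coord _ _ _ _ _ (fun x => sumf x b')) (definable_sub _ QD);
    last by move=> ?; left.
  by move=> [i|v]; [left; exists i|right; exists (b' v) => //; right].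
- by [].
- by rewrite -!PQ.
have D1 : definable N (fun v => Q (sumf e0 v)).
  apply: (@definable_coord _ _ _ _ _ (fun x => sumf e0 x)) QD.
  by move=> [i|v]; [right; exists (e0 i)|left; exists v].
exact: (nQb' (bb' _ D1 Qb)).
Qed.

Lemma coheir_image E B s : aut N s -> coheir E B -> coheir (s @` E) (s @` B).
Proof.
move=> sN co V P u PD uE Pu; have [s_aut sfix] := sN.
have /choice[v vP] : forall x, exists y, E y /\ s y = u x.
  by move=> x; have [y Ey yx] := uE x; exists y.
have uv : u = s \o v by apply: funext => x /=; case: (vP x).
have [|||u0 u0N Pu0] := co V (fun x => P (s \o x)) v.
- apply: definable_conj => //; apply: definable_sub PD => x [Nx|[y By <-]].
    by exists x; [left|rewrite sfix].
  by exists y => //; right.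
- by move=> x; case: (vP x).
- by rewrite -uv.
exists (s \o u0) => // x /=; rewrite sfix //.
Qed.

Context (K : Type).
Hypothesis sat_M : saturated M K.
Hypothesis hom_M : strongly_homogeneous M K.
Hypothesis small_countable :
  forall A B : set M, small K A -> countable B -> small K (A `|` B).

Lemma small_sub A B : A `<=` B -> small K B -> small K A.
Proof. by move=> AB sB KA; apply/sB/(card_le_trans KA)/subset_card_le. Qed.

Lemma countable_range T (E : set T) x : countable E -> E x ->
  exists u : nat -> T, range u = E.
Proof.
move=> /countable_injP[f fI] Ex.
have /choice[u uP] : forall n, exists y, E y /\ forall z, E z -> f z = n -> y = z.
  move=> n; have [[y [Ey <-]]|nE] := pselect (exists y, E y /\ f y = n).
    by exists y; split=> // z Ez /fI -> //; rewrite inE.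
  by exists x; split=> // z Ez zn; case: nE; exists z.
exists u; apply/seteqP; split=> [_ [n _ <-]|z Ez]; first by case: (uP n).
by exists (f z) => //; case: (uP (f z)) => _ /(_ z Ez erefl).
Qed.

(** The type of [E] over [N] and [B] is consistent with the negations of all formulas over [N] and
    [B'] without solution in [N], since finite parts are satisfied in [N]. A realization is a coheir
    over [B']; moving it back to [E] moves [B']. *)
Lemma coheir_extend E B B' : small K (N `|` B') -> countable E -> B `<=` B' ->
  coheir E B -> exists2 s, aut (N `|` B) s & coheir E (s @` B').
Proof.
move=> sB' cE BB' co.
have [->|/set0P[x0 Ex0]] := eqVneq E set0.
  by exists id; [exact: aut_id|exact: coheir_set0].
have [u uE] := countable_range cE Ex0.
pose F (P : (nat -> M) -> Prop) := (definable (N `|` B) P /\ P u) \/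
  (exists2 Q, definable (N `|` B') Q /\ (forall u0, (forall i, N (u0 i)) -> ~ Q u0) &
     P = (fun x => ~ Q x)).
have [P|t tF|v vF] := @realize _ _ _ sat_M small_countable (N `|` B') _ F sB'.
- case=> [[PD _]|[Q [QD _] ->]]; last exact: definable_not.
  by apply: definable_sub PD => x [|/BB']; [left|right].
- have [|||u0 u0N u0P] := co nat
    (fun x => forall P, List.In P t -> definable (N `|` B) P /\ P u -> P x) u.
  + apply: definable_all_In => P Pt; have [PDu|nP] := pselect (definable (N `|` B) P /\ P u).
      by apply: definable_iff (PDu.1) => x; split=> [H|//]; exact: H PDu.
    by apply: definable_iff (definable_true _ _) => x; split=> // _ /nP.
  + by move=> i; rewrite -uE; exists i.
  + by move=> P _ [].
  exists u0 => P Pt; have [PDu|[Q [_ nQ] ->]] := tF P Pt; first exact: u0P.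
  exact: nQ.
have [||s sNB su] := @homogeneity _ _ _ hom_M small_countable (N `|` B) _ u v.
- by apply: small_sub sB' => x [|/BB']; [left|right].
- by move=> P PD Pu; apply: vF; left.
have [s' [s'NB sK s'K]] := aut_inv sNB.
exists s' => //.
have -> : E = s' @` (range v).
  by rewrite -uE -su; apply/seteqP; split=> [_ [i _ <-]|_ [_ [i _ <-] <-]] /=;
    [exists (s (u i)); [exists i|rewrite sK]|exists i; rewrite ?sK].
apply: coheir_image; first by apply: aut_sub s'NB; apply: subsetUl.
move=> V P w PD wv Pw; apply: contrapT => nN.
have /choice[h hP] : forall x, exists i, v i = w x.
  by move=> x; have [i _ ix] := wv x; exists i.
have hw : v \o h = w by apply: funext => x /=; rewrite hP.
suff : ~ P (v \o h) by rewrite hw.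
apply: (vF (fun x => ~ P (x \o h))); right; exists (fun x => P (x \o h)) => //.
split; first exact: definable_reindex.
by move=> u0 u0N Pu0; apply: nN; exists (u0 \o h) => // x; apply: u0N.
Qed.

Lemma coheir_extend_image E B B' : small K (N `|` B') -> countable E -> B `<=` B' ->
  coheir E B -> exists2 s, aut (N `|` B) s & coheir (s @` E) B'.
Proof.
move=> sB' cE BB' co; have [s sNB cs] := coheir_extend sB' cE BB' co.
have [t [tNB sK tK]] := aut_inv sNB; exists t => //.
have -> : B' = t @` (s @` B').
  by rewrite image_comp; apply/seteqP; split=> [x Bx|_ [x Bx <-]] /=;
    [exists x => //=; rewrite sK|rewrite sK].
by apply: coheir_image cs; apply: aut_sub tNB; apply: subsetUl.
Qed.

End Coheirs.

(** * Dividing and NTP2 *)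

Section Dividing.
Context (L : language) (M : structure L) (K : Type).
Hypothesis sat_M : saturated M K.
Hypothesis hom_M : strongly_homogeneous M K.
Hypothesis small_countable :
  forall A B : set M, small K A -> countable B -> small K (A `|` B).
Implicit Types (A B C D E N : set M).

(* For [X] the set defined by [phi(x, b)], the preimages of [X] under automorphisms over [A]
   are the sets defined by the [phi(x, b')] with [b'] of the same type as [b] over [A]. *)
Definition dividing A Z (X : (Z -> M) -> Prop) :=
  exists k (s : nat -> M -> M), (forall i, aut A (s i)) /\
    forall j : 'I_k -> nat, injective j -> ~ exists x, forall i, X (s (j i) \o x).

Lemma dividing_sub A Z (X Y : (Z -> M) -> Prop) :
  (forall x, X x -> Y x) -> dividing A Y -> dividing A X.
Proof.
move=> XY [k [s [sA Ys]]]; exists k, s; split=> // j jI [x xX].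
by apply: (Ys j jI); exists x => i; apply: XY.
Qed.

Lemma dividing_base A B Z (X : (Z -> M) -> Prop) : A `<=` B -> dividing B X -> dividing A X.
Proof.
by move=> AB [k [s [sB sX]]]; exists k, s; split=> // i; apply: aut_sub AB _.
Qed.

Lemma dividing_reindex A Z W (r : W -> Z) (X : (W -> M) -> Prop) :
  dividing A X -> dividing A (fun x : Z -> M => X (x \o r)).
Proof.
move=> [k [s [sA sX]]]; exists k, s; split=> // j jI [x xX].
by apply: (sX j jI); exists (x \o r).
Qed.

Lemma dividing_aut A Z (X : (Z -> M) -> Prop) s : aut A s ->
  dividing A X -> dividing A (fun x => X (s \o x)).
Proof.
move=> sA [k [t [tA tX]]]; have [s' [s'A sK s'K]] := aut_inv sA.
exists k, (fun i => s' \o t i); split=> [i|j jI [x xX]]; first exact: aut_comp.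
apply: (tX j jI); exists x => i; congr X : (xX i).
by apply: funext => z /=; rewrite s'K.
Qed.

Lemma aut_sumf A Z W (R : (Z + W -> M) -> Prop) s x b : aut A s -> definable A R ->
  R (sumf (s \o x) (s \o b)) <-> R (sumf x b).
Proof. by move=> sA RD; rewrite -sumf_comp; apply: aut_definable sA RD. Qed.

(** Moving the variables by [s] amounts to moving the parameters by its inverse; this translates
    [dividing] into conjugate instances. *)
Lemma aut_sumfl A Z W (R : (Z + W -> M) -> Prop) s t x b :
  aut A s -> aut A t -> cancel s t -> cancel t s -> definable A R ->
  R (sumf (s \o x) b) <-> R (sumf x (t \o b)).
Proof.
move=> sA tA sK tK RD; rewrite -(aut_sumf (s \o x) b tA RD).
by have -> : t \o (s \o x) = x by apply: funext => z /=; rewrite sK.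
Qed.

Lemma psat_inst n m (phi : formula L ('I_n + 'I_m)) (a : 'I_m -> M) x :
  psat x (inst phi a) <-> sat (sumf x a) phi.
Proof. by rewrite /psat /inst sat_rename; split; apply: sat_eqfun => -[]. Qed.

Hypothesis ntp2 : NTP2 M.

(* Compactness makes NTP2 uniform: finitely many k-inconsistent rows already have an
   inconsistent path. *)
Lemma NTP2_rows A Z W (R : (Z + W -> M) -> Prop) k : small K A -> definable A R ->
  exists r, forall a : nat -> nat -> W -> M,
    (forall i, i < r -> forall j : 'I_k -> nat, injective j ->
       ~ exists x, forall l, R (sumf x (a i (j l)))) ->
    exists f : nat -> nat, ~ exists x, forall i, i < r -> R (sumf x (a i (f i))).
Proof.
move=> s0 [t [_ tR]]; apply: contrapT => /forallNP H.
have {}H r : exists a : nat -> nat -> W -> M,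
    (forall i, i < r -> forall j : 'I_k -> nat, injective j ->
       ~ exists x, forall l, R (sumf x (a i (j l)))) /\
    (forall f : nat -> nat, exists x, forall i, i < r -> R (sumf x (a i (f i)))).
  have /existsNP[a /not_implyP[h1 /forallNP h2]] := H r.
  by exists a; split=> // f; apply: contrapT.
have [a aP] := choice H.
have [q r g supp] := formula_supportP t; have [m0] := Defs.nonempty M.
(* [TP2] concerns formulas without parameters in finite tuples, so the parameters of [t] join the
   block of [y]. *)
pose rho (s : (Z + W) + M) : 'I_q.+1 + 'I_q.+1 :=
  match s with inl (inl z) => inl (r s) | _ => inr (r s) end.
pose phi := rename rho t.
pose cvt (v : Z + W -> M) i := if g i is Some s then sumf v id s else m0.
pose cvr (y : W -> M) := cvt (sumf (fun=> m0) y).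
have c1 x y : R (sumf x y) -> sat (sumf (cvt (sumf x (fun=> m0))) (cvr y)) phi.
  move=> /tR h; rewrite sat_rename.
  apply: (iffLR (sat_ext _ supp)) h => -[[z|w]|c] /= e; rewrite /cvr /cvt /= ?e //.
have c2 x y : sat (sumf x (cvr y)) phi -> R (sumf (x \o r \o inl \o inl) y).
  rewrite sat_rename => h; apply/tR.
  apply: (iffLR (sat_ext _ supp)) h => -[[z|w]|c] /= e; rewrite /cvr /cvt /= ?e //.
have s0' : small K (@set0 M) := small_sub (@sub0set _ A) s0.
pose V := (nat * nat * 'I_q.+1)%type.
(* The array [a n] meets the requirements on rows below [n] and on initial segments of paths of
   length at most [n], so a finite part of [F] holds for all large [n]. *)
pose F (P : (V -> M) -> Prop) :=
  (exists i (j : 'I_k -> nat), injective j /\ P = (fun u => ~ exists x : 'I_q.+1 -> M,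
     forall l, sat (sumf x (fun c => u (i, j l, c))) phi)) \/
  (exists (f : nat -> nat) m, P = (fun u => exists x : 'I_q.+1 -> M,
     forall i, i < m -> sat (sumf x (fun c => u (i, f i, c))) phi)).
have [P|ps psF|u uF] := @realize _ _ _ sat_M small_countable set0 _ F s0'.
- case=> [[i [j [_ ->]]]|[f [m ->]]].
    apply/definable_not/(@definable_ex _ _ _ _ 'I_q.+1 (fun v => forall l : 'I_k,
       sat (sumf (v \o inr) (fun c => v (inl (i, j l, c)))) phi)).
    apply: definable_all_fin => l; apply: (definable_coord (F := fun v => sumf (v \o inr)
      (fun c => v (inl (i, j l, c)))) _ (definable_sat _ phi)).
    by move=> [z|c]; left; [exists (inr z)|exists (inl (i, j l, c))].
  apply: (@definable_ex _ _ _ _ 'I_q.+1 (fun v => forall i, i < m ->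
       sat (sumf (v \o inr) (fun c => v (inl (i, f i, c)))) phi)).
  apply: definable_forall_lt => i _; apply: (definable_coord (F := fun v => sumf (v \o inr)
      (fun c => v (inl (i, f i, c)))) _ (definable_sat _ phi)).
  by move=> [z|c]; left; [exists (inr z)|exists (inl (i, f i, c))].
- pose u n (v : V) := cvr (a n v.1.1 v.1.2) v.2.
  suff [n nP] : exists n, forall m, n <= m -> satisfies ps (u m).
    by exists (u n); apply: nP.
  elim: ps psF => [|P ps IH] psF; first by exists 0 => m _ P [].
  have [|n nP] := IH; first by move=> Q Qps; apply: psF; right.
  suff [n' n'P] : exists n, forall m, n <= m -> P (u m).
    exists (maxn n n') => m; rewrite geq_max => /andP[nm n'm] Q /= [<-|].
      exact: n'P.
    exact: nP.
  have [[i [j [jI ->]]]|[f [m ->]]] := psF P (or_introl erefl).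
    exists i.+1 => m im [x xP]; have [h _] := aP m; apply: (h i im j jI).
    by exists (x \o r \o inl \o inl) => l; apply: c2; apply: xP.
  exists m => m' mm'; have [_ h] := aP m'; have [x xP] := h f.
  exists (cvt (sumf x (fun=> m0))) => i im.
  exact: c1 (xP i (leq_trans im mm')).
apply: (ntp2 (phi := phi)); exists (fun i j c => u (i, j, c)), k; split.
  move=> i j jI [x xP].
  apply: (uF (fun u => ~ exists x : 'I_q.+1 -> M,
     forall l, sat (sumf x (fun c => u (i, j l, c))) phi)); first by left; exists i, j.
  by exists x => l; apply/psat_inst/xP.
move=> f G finG Gsub.
have [n nP] : exists n, forall th, G th -> exists2 i, i < n &
    th = inst phi (fun c => u (i, f i, c)).
  have [s sE] := finite_set_In finG; rewrite {}sE in Gsub *.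
  elim: s Gsub {G finG} => [|th s IH] sub; first by exists 0.
  have [|n nP] := IH; first by move=> th' ths; apply: sub; right.
  have [i _ ith] := sub th (or_introl erefl).
  exists (maxn n i.+1) => th' /= [<-|/nP[l ln ->]].
    by exists i => //; rewrite leq_max ltnSn orbT.
  by exists l => //; rewrite leq_max ln.
have [x xP] : exists x : 'I_q.+1 -> M,
     forall i, i < n -> sat (sumf x (fun c => u (i, f i, c))) phi.
  by apply: (uF (fun u => exists x : 'I_q.+1 -> M,
     forall i, i < n -> sat (sumf x (fun c => u (i, f i, c))) phi)); right; exists f, n.
by exists x => th /nP[i ni ->]; apply/psat_inst/xP.
Qed.

End Dividing.

(** * The broom lemma *)

Lemma countable_range_fun (W : countType) T (u : W -> T) : countable (range u).
Proof. exact: card_le_trans (card_image_le _ _) (countableP _). Qed.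

Lemma countable_setU T (A B : set T) : countable A -> countable B -> countable (A `|` B).
Proof. by move=> cA cB; rewrite -bigcup2E; apply: bigcup_countable => // -[|[|i]]. Qed.

Lemma In_nth T (x0 x : T) s : List.In x s -> exists2 i, i < size s & nth x0 s i = x.
Proof.
elim: s => //= y s IH [->|/IH[i lt ix]]; first by exists 0.
by exists i.+1.
Qed.

Lemma nth_In T (x0 : T) s i : i < size s -> List.In (nth x0 s i) s.
Proof. by elim: s i => //= y s IH [|i]; [left|move=> /IH; right]. Qed.

Section Broom.
Context (L : language) (M : structure L) (K : Type).
Hypothesis sat_M : saturated M K.
Hypothesis hom_M : strongly_homogeneous M K.
Hypothesis small_countable :
  forall A B : set M, small K A -> countable B -> small K (A `|` B).
Hypothesis ntp2 : NTP2 M.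
Context (N : set M).
Hypothesis small_N : small K N.
Hypothesis elem_N : elementary N.
Implicit Types (A B C D E : set M).

Lemma elementary_witness V (P : (V -> M) -> Prop) u : definable N P -> P u ->
  exists2 u0, (forall v, N (u0 v)) & P u0.
Proof. by move=> PD; apply: elem_N => //; apply: definable_sub PD => x; left. Qed.

Lemma coheir_elementary E : coheir N E set0.
Proof. exact: coheir_sub elem_N. Qed.

(** As [N] is elementary, [E] is a coheir over the empty set; extending this to the union of the
    earlier copies yields the next one. *)
Lemma coheir_copies E : countable E -> exists (s : nat -> M -> M),
  (forall n, aut N (s n)) /\
  forall n, coheir N (s n @` E) (\bigcup_(i in [set i | i < n]) (s i @` E)).
Proof.
move=> cE.
have /choice[next nextP] : forall D, exists s, aut N s /\ (countable D -> coheir N (s @` E) D).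
  move=> D; have [cD|nD] := pselect (countable D); last by exists id; split=> //; exact: aut_id.
  have [s sN cs] := coheir_extend_image sat_M hom_M small_countable
    (small_countable small_N cD) cE (@sub0set _ D) (@coheir_elementary E).
  by exists s; split=> //; apply: aut_sub sN; apply: subsetUl.
pose D n := iter n (fun D => D `|` next D @` E) set0.
have cD n : countable (D n).
  elim: n => [|n IH]; first exact: countable0.
  by apply: countable_setU => //; apply: card_le_trans (card_image_le _ _) cE.
have DD i n : i < n -> next (D i) @` E `<=` D n.
  elim: n => //= n IH; rewrite ltnS leq_eqVlt => /orP[/eqP->|/IH h] x; first by right.
  by move=> /h; left.
exists (fun n => next (D n)); split=> n; first by case: (nextP (D n)).
have [_ /(_ (cD n))] := nextP (D n).
by apply: coheir_sub => // x [i /= /DD] /[apply]; right.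
Qed.

(** Dividing in terms of parameters: the inverse automorphisms give the conjugates of [b]. Allowing
    a further [s] makes it possible to copy the whole witness as a row of an array. *)
Lemma dividing_witness A (Z W : Type) (R : (Z + W -> M) -> Prop) b :
  definable A R -> dividing A (fun x => R (sumf x b)) ->
  exists k (t : nat -> M -> M), (forall i, aut A (t i)) /\
    forall s, aut A s -> forall j : 'I_k -> nat, injective j ->
      ~ exists x, forall i, R (sumf x (s \o (t (j i) \o b))).
Proof.
move=> RD [k [s [sA sR]]].
have /choice[t tP] := fun i => aut_inv (sA i).
exists k, t; split=> [i|u uA j jI [x xP]]; first by case: (tP i).
have [u' [u'A uK u'K]] := aut_inv uA.
apply: (sR j jI); exists (u' \o x) => i; have [tA tK t'K] := tP (j i).
rewrite (aut_sumfl _ _ (sA _) tA) // (aut_sumfl _ _ u'A uA) //.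
Qed.

(* The rows are copies of a sequence witnessing dividing, each a coheir over the previous
   ones; NTP2 yields an inconsistent path, which is the required coheir sequence. *)
Lemma dividing_coheir Z (W : countType) (R : (Z + W -> M) -> Prop) b :
  definable N R -> dividing N (fun x => R (sumf x b)) ->
  exists r (s : nat -> M -> M), (forall i, aut N (s i)) /\
    (forall n, coheir N (range (s n \o b)) (\bigcup_(i in [set i | i < n]) range (s i \o b))) /\
    ~ exists x, forall i, i < r -> R (sumf x (s i \o b)).
Proof.
move=> RD /(dividing_witness RD) [k [t [tN tR]]].
have [s [sN sE]] := coheir_copies (countable_range_fun (fun p : nat * W => t p.1 (b p.2))).
have [r rP] := NTP2_rows sat_M small_countable ntp2 k small_N RD.
have [|f fP] := rP (fun i j => s i \o (t j \o b)).
  by move=> i _ j; apply: tR.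
exists r, (fun i => s i \o t (f i)); split=> [i|]; first exact: aut_comp.
split=> // n; apply: coheir_sub (sE n).
  by move=> _ [w _ <-]; exists (t (f n) (b w)) => //; exists (f n, w).
move=> _ [i /= lt [w _ <-]]; right; exists i => //.
by exists (t (f i) (b w)) => //; exists (f i, w).
Qed.

(* Finitely many conjugates of [X] over [N] have their intersection inside [Y]. *)
Definition cofin Z (X Y : (Z -> M) -> Prop) := exists s : seq (M -> M),
  (forall f, List.In f s -> aut N f) /\
  forall x, (forall f, List.In f s -> X (f \o x)) -> Y x.

Lemma cofin_sub Z (X Y : (Z -> M) -> Prop) : (forall x, X x -> Y x) -> cofin X Y.
Proof.
move=> XY; exists [:: id]; split=> [f /= [<-|//]|x H]; first exact: aut_id.
by apply: XY; apply: (H id); left.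
Qed.

Lemma cofin_trans Z (X Y U : (Z -> M) -> Prop) : cofin X Y -> cofin Y U -> cofin X U.
Proof.
move=> [s [sN XY]] [t [tN YU]].
exists (List.flat_map (fun f => List.map (fun g => g \o f) s) t); split.
  by move=> h /List.in_flat_map [f [/tN ft /List.in_map_iff [g [<- /sN gs]]]]; apply: aut_comp.
move=> x H; apply: YU => f ft; apply: XY => g gs.
apply: (H (g \o f)); apply/List.in_flat_map; exists f; split=> //.
by apply/List.in_map_iff; exists g.
Qed.

(* The Broom lemma of Chernikov and Kaplan. To remove [R n], take [c 0, ..., c (r - 1)] as in
   [dividing_coheir], below [E], and the conjugates of [X] that move [c l] to [b] and fix [E]:
   the intersection of these avoids the inconsistent intersection of the [R n (x, c l)]. The
   remaining [R i (x, c l)], [i < n], are removed for [l = 0, 1, ...] in turn by induction,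
   with the [c l'], [l' > l], adjoined to [E]. *)
Lemma broom Z (W : countType) n (R : nat -> (Z + W -> M) -> Prop) :
  (forall i, i < n -> definable N (R i)) ->
  forall (b : W -> M), (forall i, i < n -> dividing N (fun x => R i (sumf x b))) ->
  forall E, countable E -> coheir N E (range b) ->
  forall X Y : (Z -> M) -> Prop, definable (N `|` E) Y ->
    (forall x, X x -> Y x \/ exists2 i, i < n & R i (sumf x b)) ->
    cofin X Y.
Proof.
elim: n => [|n IH] RD b Rdiv E cE cohE X Y YD XYR.
  by apply: cofin_sub => x /XYR [//|[]].
have [r [s [sN [cohs sR]]]] := dividing_coheir (RD n (ltnSn n)) (Rdiv n (ltnSn n)).
pose B := range b `|` \bigcup_(i in [set i | i < r]) range (s i \o b).
have cB : countable B.
  apply: countable_setU; first exact: countable_range_fun.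
  by apply: bigcup_countable => // i _; apply: countable_range_fun.
have [t tNb cohEt] := coheir_extend sat_M hom_M small_countable
  (small_countable small_N cB) cE (@subsetUl _ _ _) cohE.
have tN : aut N t by apply: aut_sub tNb; apply: subsetUl.
pose c i := t \o (s i \o b).
have bt : t \o b = b.
  by apply: funext => w /=; case: tNb => _; apply; right; exists w.
have Bb w : (t @` B) (b w).
  by exists (b w); [left; exists w|exact: (congr1 (@^~ w) bt)].
have Bc i w : i < r -> (t @` B) (c i w).
  by move=> lt; exists (s i (b w)) => //; right; exists i => //; exists w.
have /choice[g gP] : forall i, exists g, i < r -> aut (N `|` E) g /\ g \o c i = b.
  move=> i; have [ir|_] := boolP (i < r); last by exists id.
  have [||g gNE gc] := @homogeneity _ _ _ hom_M small_countable (N `|` E) W (c i) b.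
  - exact: small_countable.
  - apply: coheir_same_type cohEt _ _ _ => [w|//|]; first exact: Bc.
    by apply: same_type_sym; rewrite -/(_ \o _); apply: aut_same_type (aut_comp tN (sN i)).
  by exists g.
pose X1 x := forall i, i < r -> X (g i \o x).
have XX1 : cofin X X1.
  exists (mkseq g r); split=> [f /(In_nth id)[i]|x H i ir].
    rewrite size_mkseq => ir <-; rewrite nth_mkseq //.
    by apply: aut_sub (gP i ir).1; apply: subsetUl.
  by apply: H; rewrite -(nth_mkseq id g ir); apply: nth_In; rewrite size_mkseq.
apply: cofin_trans XX1 _.
pose Y1 j x := Y x \/ exists2 l, l < r & j <= l /\ exists2 i, i < n & R i (sumf x (c l)).
(* If [x] is not in [Y1 0], then for every [i < r] the hypothesis on [X] at [g i x] leaves only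
   [R n (x, c i)], and [sR] forbids this for all [i] together. *)
have X1Y1 : forall x, X1 x -> Y1 0 x.
  move=> x X1x; apply: contrapT => nY.
  apply: sR; have [t' [t'N tK t'K]] := aut_inv tN.
  exists (t' \o x) => i ir; rewrite (aut_sumfl _ _ t'N tN) //; last exact: RD.
  have [gNE gc] := gP i ir.
  have gN : aut N (g i) by apply: aut_sub gNE; apply: subsetUl.
  have [|[l]] := XYR _ (X1x i ir).
    by rewrite (aut_definable _ gNE YD) => Yx; case: nY; left.
  move=> ln1 Rl.
  have {}Rl : R l (sumf x (c i)).
    by rewrite -(aut_sumf _ _ gN (RD l ln1)) gc.
  move: ln1; rewrite ltnS leq_eqVlt => /orP[/eqP <- //|ln].
  by case: nY; right; exists i => //; split=> //; exists l.
suff Yj : forall j, j <= r -> cofin X1 (Y1 j).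
  apply: cofin_trans (Yj r (leqnn r)) (cofin_sub _) => x.
  by case=> [//|[l]]; rewrite ltnNge => /negP lr [].
elim=> [|j IHj] jr; first exact: cofin_sub X1Y1.
apply: cofin_trans (IHj (ltnW jr)) _.
pose U p q := \bigcup_(i in [set i | p <= i < q]) range (c i).
have Uc p q i : p <= i < q -> range (c i) `<=` U p q by move=> pq x xi; exists i.
have cohc i : coheir N (range (c i)) (U 0 i).
  have := coheir_image tN (cohs i); apply: coheir_sub.
    by move=> _ [w _ <-]; exists (s i (b w)) => //; exists w.
  move=> _ [l /= li [w _ <-]]; right; exists (s l (b w)) => //.
  by exists l => //; exists w.
(* The induction hypothesis at [c j] needs [E] with the later [c l] to be a coheir over [c j]. The
   later [c l] are one because the [c l] form a coheir sequence, and [E] is a coheir over all of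
   them. *)
have cohU q : j < q -> q <= r -> coheir N (U j.+1 q) (U 0 j.+1).
  elim: q => // q IHq; rewrite ltnS leq_eqVlt => /orP[/eqP <- _|jq qr].
    apply: coheir_sub (@coheir_set0 _ _ N (U 0 j.+1)) => // x [l /=].
    by move=> /andP[jl]; rewrite ltnNge jl.
  apply: (@coheir_sub _ _ _ (range (c q) `|` U j.+1 q) _ (U 0 j.+1))  => [x|//|].
    move=> [l /= /andP[jl]]; rewrite ltnS leq_eqVlt => /orP[/eqP ->|lq xl]; first by left.
    by right; exists l => //=; rewrite jl.
  apply: coheir_trans (IHq jq (ltnW qr)); apply: coheir_sub (cohc q) => // x [] h; right.
    by case: h => l /= lj xl; exists l => //=; apply: leq_trans lj jq.
  by case: h => l /= /andP[_ lq] xl; exists l.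
have cohE' : coheir N (E `|` U j.+1 r) (range (c j)).
  apply: (@coheir_sub _ _ _ (E `|` U j.+1 r) _ (U 0 j.+1)) => //.
    by move=> x xj; right; exists j => //=.
  apply: coheir_trans (cohU r jr (leqnn r)); apply: coheir_sub cohEt => // x h; right.
  suff [l lr [w _ <-]] : exists2 l, l < r & range (c l) x by exact: Bc.
  case: h => -[l /= h xl]; exists l => //; last by case/andP: h.
  exact: leq_trans h jr.
have [u [uN uK Ku]] := aut_inv (aut_comp tN (sN j)).
apply: (IH _ (c j) _ (E `|` U j.+1 r)) => //.
- by move=> i lt; apply/RD/ltnW.
- move=> i lt; have := dividing_aut uN (Rdiv i (ltnW lt)); apply: dividing_sub => x.
  by rewrite (aut_sumfl _ _ uN (aut_comp tN (sN j))) //; apply/RD/ltnW.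
- apply: countable_setU => //; apply: bigcup_countable => // l _.
  exact: countable_range_fun.
- apply: definable_or; first by apply: definable_sub YD => x [|]; [left|right; left].
  apply: definable_exists_lt => l lr; apply: definable_andb => jl.
  apply: definable_exists_lt => i lt.
  apply: (definable_coord (F := fun x => sumf x (c l)) _ (definable_sub _ (RD i (ltnW lt)))).
    move=> [z|w]; [by left; exists z|right; exists (c l w) => //].
    by right; right; exists l; [rewrite /= jl|exists w].
  by move=> x; left.
- move=> x [Yx|[l lr [jl [i lt Rl]]]]; first by left; left.
  move: jl; rewrite leq_eqVlt => /orP[/eqP jl|jl]; first by right; exists i => //; rewrite jl.
  by left; right; exists l => //; split=> //; exists i.
Qed.

End Broom.

(** * Strictly nonforking copies *)

Section Strict.
Context (L : language) (M : structure L) (K : Type).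
Hypothesis sat_M : saturated M K.
Hypothesis hom_M : strongly_homogeneous M K.
Hypothesis small_countable :
  forall A B : set M, small K A -> countable B -> small K (A `|` B).
Hypothesis ntp2 : NTP2 M.
Implicit Types (A B C D E N : set M).

(* No formula in the type of [D] over [A] and [b] divides over [A]. *)
Definition nondividing A D (W : Type) (b : W -> M) := forall k (e : 'I_k -> M) Q,
  (forall i, D (e i)) -> definable A Q -> Q (sumf e b) -> ~ dividing A (fun x => Q (sumf x b)).

(* [z] realizes an heir of the type of [z0] that does not divide over [N]. If there were none,
   a formula [g] of that type would imply a disjunction of [Q(z, b)], with [Q(z0, y)] not
   satisfied in [N], and of dividing formulas. By the broom lemma [g] implies a finite disjunction
   of conjugates of [Q(z, b)], hence of formulas [Q(z, y)] with [y] in [N], contradicting the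
   choice of [Q] at [z0]. *)
Lemma strict_tuple N (W : countType) (b : W -> M) (z0 : nat -> M) :
  small K N -> elementary N ->
  exists s, [/\ aut N s, coheir N (range b) (range (s \o z0)) &
    forall Q, definable N Q -> Q (sumf (s \o z0) b) -> ~ dividing N (fun x => Q (sumf x b))].
Proof.
move=> small_N elem_N.
pose heir (Q : (nat + W -> M) -> Prop) :=
  forall y, (forall w, N (y w)) -> ~ Q (sumf z0 y).
pose F (P : (nat -> M) -> Prop) := (definable N P /\ P z0) \/
  (exists Q, [/\ definable N Q, heir Q \/ dividing N (fun x => Q (sumf x b)) &
    P = (fun x => ~ Q (sumf x b))]).
have small_Nb : small K (N `|` range b).
  by apply: small_countable => //; apply: countable_range_fun.
have [P|ps psF|z zF] := realize sat_M small_countable (F := F) small_Nb.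
- case=> [[PD _]|[Q [QD _ ->]]]; first by apply: definable_sub PD => x; left.
  apply: definable_not; apply: (definable_coord (F := fun x => sumf x b) _ (definable_sub _ QD)).
    by move=> [n|w]; [left; exists n|right; exists (b w) => //; right; exists w].
  by move=> x; left.
- have [g [Q [n [R [[gD gz] QD Qh RD sat]]]]] : exists g Q n (R : nat -> (nat + W -> M) -> Prop),
      [/\ definable N g /\ g z0, definable N Q, heir Q,
        forall i, i < n -> definable N (R i) /\ dividing N (fun x => R i (sumf x b)) &
        forall z, g z -> ~ Q (sumf z b) -> (forall i, i < n -> ~ R i (sumf z b)) ->
          satisfies ps z].
    elim: ps psF => [|P ps IH] psF.
      exists (fun=> True), (fun=> False), 0, (fun _ _ => False); split=> //.
      + by split=> //; apply: definable_true.
      + exact: definable_false.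
      + by move=> y yN.
      + by move=> y _ _ _ P [].
    have [|g [Q [n [R [[gD gz] QD Qh RD sat]]]]] := IH.
      by move=> P' P'ps; apply: psF; right.
    case: (psF P (or_introl erefl)) => [[PD Pz]|[Q' [Q'D Q'P PE]]].
      exists (fun x => g x /\ P x), Q, n, R; split=> //.
        by split=> //; apply: definable_and.
      by move=> x [gx Px] nQ nR P' /= [<-//|]; apply: sat nR P'.
    case: Q'P => [Q'h|Q's].
      exists g, (fun x => Q x \/ Q' x), n, R; split=> //; first exact: definable_or.
        by move=> y yN [/(Qh y yN)|/(Q'h y yN)].
      move=> x gx /not_orP[nQ nQ'] nR P' /= [<-|]; first by rewrite PE.
      by apply: sat nR P'.
    exists g, Q, n.+1, (fun i => if i is i'.+1 then R i' else Q'); split=> //.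
      by case=> //= i; rewrite ltnS => /RD.
    move=> x gx nQ nR P' /= [<-|]; first by rewrite PE; apply: (nR 0).
    by apply: sat => // i lt; apply: (nR i.+1).
  apply: contrapT => /forallNP nsat.
  have [||s [sN sF]] := @broom _ _ _ sat_M hom_M small_countable ntp2 N small_N elem_N
    nat W n R (fun i lt => (RD i lt).1) b (fun i lt => (RD i lt).2) set0 _ (@coheir_set0 _ _ N _)
    (fun x => g x /\ ~ Q (sumf x b)) (fun=> False) (definable_false _ _).
  + exact: countable0.
  + move=> x [gx nQ]; right; apply: contrapT => nR; apply: (nsat x); apply: sat => // i lt Ri.
    by apply: nR; exists i.
  have /choice[t tP] : forall i, exists t, i < size s ->
      [/\ aut N t, cancel (nth id s i) t & cancel t (nth id s i)].
    move=> i; have [lt|_] := boolP (i < size s); last by exists id.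
    by have [t ?] := aut_inv (sN _ (nth_In id lt)); exists t.
  pose P (y : nat * W -> M) := forall x : nat -> M,
    g x -> exists2 i, i < size s & Q (sumf x (fun w => y (i, w))).
  have [||y yN yP] := @elementary_witness _ _ N elem_N _ P (fun p => t p.1 (b p.2)).
  + apply: (@definable_all _ _ _ _ nat (fun v => g (v \o inr) ->
      exists2 i, i < size s & Q (sumf (v \o inr) (fun w => v (inl (i, w)))))).
    apply: definable_imp; first exact: definable_reindex.
    apply: definable_exists_lt => i lt; apply: (definable_coord (F := fun v => sumf (v \o inr)
      (fun w => v (inl (i, w)))) _ QD).
    by move=> [m|w]; left; [exists (inr m)|exists (inl (i, w))].
  + move=> x gx; apply: contrapT => nP; apply: (sF x) => f fs.
    split; first by apply/(aut_definable _ (sN f fs) gD).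
    have [i lt fE] := In_nth id fs; have [tN tK Kt] := tP i lt.
    rewrite -fE (aut_sumfl _ _ _ tN) //; last by rewrite fE; apply: sN.
    by move=> Qx; apply: nP; exists i.
  have [i _] := yP z0 gz.
  by apply: Qh => w; apply: yN.
have [|s sN sz] := homogeneity hom_M small_countable (a := z0) (b := z) small_N.
  by move=> P PD Pz; apply: zF; left.
exists s; rewrite sz; split=> //; last first.
  move=> Q QD Qz sQ; apply: (zF (fun x => ~ Q (sumf x b))) Qz.
  by right; exists Q; split=> //; right.
(* An heir read from the other side is a coheir: a formula over [N] and [z] that holds of a tuple
   from [b] but of none in [N] has been excluded by the first alternative in [F]. *)
move=> V P u /definable_split [k [e [Q [ez QD PQ]]]] ub Pu.
have /choice[h hP] : forall i, exists n, z n = e i.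
  by move=> i; have [n _ nE] := ez i; exists n.
have /choice[h' h'P] : forall x, exists w, b w = u x.
  by move=> x; have [w _ wE] := ub x; exists w.
pose re (v : nat + W -> M) x :=
  match x with inl i => v (inl (h i)) | inr x => v (inr (h' x)) end.
pose Q' v := Q (re v).
have QQ' : Q' (sumf z b) <-> P u.
  rewrite PQ /Q'; have -> // : re (sumf z b) = sumf e u.
  by apply: funext => -[i|x] /=; rewrite ?hP ?h'P.
have Q'D : definable N Q'.
  apply: (definable_coord (F := re) _ QD).
  by move=> [i|x]; left; [exists (inl (h i))|exists (inr (h' x))].
apply: contrapT => nN; apply: (zF (fun x => ~ Q' (sumf x b))); last by apply/QQ'.
right; exists Q'; split=> //; left => y yN Q'y; apply: nN.
exists (y \o h'); first by move=> x; apply: yN.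
rewrite PQ; have {}Q'y : Q' (sumf z y).
  have -> : y = s \o y by apply: funext => w /=; case: sN => _ ->.
  by rewrite -sz; apply/(aut_sumf _ _ sN).
move: Q'y; rewrite /Q'; have -> // : re (sumf z y) = sumf e (y \o h').
by apply: funext => -[i|x] //=; rewrite hP.
Qed.

(** [strict_tuple] moves an enumeration of [D]; the inverse automorphism moves [b] and leaves [D] in
    place. *)
Lemma strict_copy N (W : countType) (b : W -> M) D :
  small K N -> elementary N -> countable D ->
  exists s, [/\ aut N s, coheir N (range (s \o b)) D & nondividing N D (s \o b)].
Proof.
move=> small_N elem_N cD; have [m0] := Defs.nonempty M.
(* [m0] ensures that there is something to enumerate. *)
have [z0 z0D] : exists z0 : nat -> M, range z0 = m0 |` D.
  apply: (@countable_range _ _ m0); last by left.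
  exact/countable_setU.
have [s [sN cohs sP]] := strict_tuple b z0 small_N elem_N.
have [t [tN sK Ks]] := aut_inv sN.
exists t; split=> //.
  have := coheir_image tN cohs; apply: coheir_sub.
    by move=> _ [w _ <-]; exists (b w) => //; exists w.
  move=> x Dx; right; have : range z0 x by rewrite z0D; right.
  by move=> [n _ nx]; exists (s x); [exists n => //=; rewrite nx|rewrite sK].
move=> k e Q eD QD Qe dv.
have /choice[h hP] : forall i, exists n, z0 n = e i.
  by move=> i; have : range z0 (e i) by [rewrite z0D; right]; move=> [n _ <-]; exists n.
pose Q' (v : nat + W -> M) := Q (sumf (v \o inl \o h) (v \o inr)).
have Q'D : definable N Q'.
  apply: (definable_coord (F := fun v => sumf (v \o inl \o h) (v \o inr)) _ QD).
  by move=> [i|w]; left; [exists (inl (h i))|exists (inr w)].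
apply: (sP Q' Q'D).
  rewrite /Q'; have -> : sumf (s \o z0) b \o inl \o h = s \o e.
    by apply: funext => i /=; rewrite hP.
  by apply/(aut_sumfl _ _ sN tN).
have := dividing_reindex h (dividing_aut tN dv); apply: dividing_sub => x.
rewrite /Q' (_ : sumf x b \o inl \o h = x \o h) // => Qx.
by apply/(aut_sumf _ _ tN).
Qed.

End Strict.

(** * Indiscernible sequences *)

Definition incr (g : nat -> nat) := {homo g : i j / i < j}.

Lemma incr_comp g h : incr g -> incr h -> incr (g \o h).
Proof. by move=> gI hI i j /hI /gI. Qed.

Lemma incrW g : (forall n, g n < g n.+1) -> incr g.
Proof. by move=> gS; apply: homo_ltn => //; apply: ltn_trans. Qed.

Lemma incr_reflect g i j : incr g -> g i < g j -> i < j.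
Proof.
move=> gI; rewrite !ltnNge; apply: contra.
by rewrite leq_eqVlt => /orP[/eqP->//|/gI/ltnW].
Qed.

Lemma incr_inj g : incr g -> injective g.
Proof. by move=> gI i j e; case: (ltngtP i j) => // /gI; rewrite e ltnn. Qed.

Lemma subsequence_monochromatic (c : nat -> Prop) :
  exists2 g, incr g & forall i j, c (g i) <-> c (g j).
Proof.
have [inf|] := pselect (forall n, exists m, n < m /\ c m).
  have [nx nxP] := choice inf.
  exists (fun i => iter i.+1 nx 0); first by apply: incrW => n; case: (nxP (iter n.+1 nx 0)).
  by move=> i j; split=> _; rewrite iterS; apply: (nxP _).2.
move=> /existsNP[n nP]; exists (fun i => n.+1 + i).
  by move=> i j; rewrite ltn_add2l.
have nc i : ~ c (n.+1 + i).
  by move=> ci; apply: nP; exists (n.+1 + i); split=> //; rewrite addSn ltnS leq_addr.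
by move=> i j; split=> /nc.
Qed.

Definition ncons (a : nat) (h : nat -> nat) i := if i is i'.+1 then h i' else a.

(** Ramsey's theorem by induction on the exponent: a [k]-element set is an increasing map of which
    only the first [k] values count. Each [next] makes the colour constant once the least element is
    fixed. *)
Lemma ramsey k (P : (nat -> nat) -> Prop) :
  (forall h h', (forall i, i < k -> h i = h' i) -> P h <-> P h') ->
  exists2 g, incr g & forall h h', incr h -> incr h' -> P (g \o h) <-> P (g \o h').
Proof.
elim: k P => [|k IH] P Pk; first by exists id => // h h' _ _; apply: Pk.
have /choice[next nextP] : forall G : nat -> nat, exists g, incr g /\
    forall h h', incr h -> incr h' ->
      P (ncons (G 0) (G \o succn \o g \o h)) <-> P (ncons (G 0) (G \o succn \o g \o h')).
  move=> G; have [|g gI gP] := IH (fun h => P (ncons (G 0) (G \o succn \o h))).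
    by move=> h h' hh; apply: Pk => -[//|i] /hh /= ->.
  by exists g.
pose G n := iter n (fun G => G \o succn \o next G) id.
have GI n : incr (G n).
  elim: n => //= n IHn; apply: incr_comp; last by case: (nextP (G n)).
  by apply: incr_comp.
pose a n := G n 0.
have aI : incr a.
  by apply: incrW => n; rewrite /a /=; apply: GI.
have aG n m : n <= m -> exists x, a m = G n x.
  suff : n <= m -> exists E, G m = G n \o E by move=> h /h [E]; rewrite /a => ->; exists (E 0).
  elim: m => [|m IHm]; first by rewrite leqn0 => /eqP->; exists id.
  rewrite leq_eqVlt => /orP[/eqP->|]; first by exists id.
  by rewrite ltnS => /IHm[E GE]; exists (E \o succn \o next (G m)); rewrite /= {1}GE.
pose c n := P (ncons (a n) (G n.+1)).
(* The terms of [a] after [a (h 0)] are values of [G (h 0).+1], so the colour depends only on the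
   least element. *)
have Pc h : incr h -> P (a \o h) <-> c (h 0).
  move=> hI; have [nI nP] := nextP (G (h 0)).
  have /choice[e eP] : forall i, exists x, a (h i.+1) = G (h 0).+1 x.
    by move=> i; apply: aG; apply: hI.
  have eI : incr e.
    move=> i j ij; apply: (incr_reflect (GI (h 0).+1)); rewrite -!eP.
    by apply/aI/hI.
  rewrite /c (nP id e) //; apply: Pk => -[//|i] _ /=; exact: eP.
have [g gI gP] := subsequence_monochromatic c.
exists (a \o g); first exact: incr_comp.
move=> h h' hI h'I.
rewrite (Pc _ (incr_comp gI hI)) (Pc _ (incr_comp gI h'I)); exact: gP.
Qed.

Lemma ramsey_list (Ps : seq ((nat -> nat) -> Prop)) :
  (forall P, List.In P Ps -> exists k, forall h h', (forall i, i < k -> h i = h' i) ->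
     P h <-> P h') ->
  exists2 g, incr g & forall P, List.In P Ps ->
    forall h h', incr h -> incr h' -> P (g \o h) <-> P (g \o h').
Proof.
elim: Ps => [|P Ps IH] PsP; first by exists id.
have [|g gI gP] := IH; first by move=> Q Qps; apply: PsP; right.
have [k kP] := PsP P (or_introl erefl).
have [|g' g'I g'P] := @ramsey k (fun h => P (g \o h)).
  by move=> h h' hh; apply: kP => i /hh /= ->.
exists (g \o g'); first exact: incr_comp.
move=> Q /= [<-|Qps] h h' hI h'I; first exact: (g'P h h').
by apply: (gP Q Qps (g' \o h) (g' \o h')); apply: incr_comp.
Qed.

(** Dividing quantifies over injective index maps, indiscernibility over increasing ones; sorting
    links the two. *)
Lemma incr_enum k (j : 'I_k -> nat) : injective j ->
  exists2 g, incr g & forall l, l < k -> exists i, g l = j i.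
Proof.
move=> jI; pose s := sort leq (codom j); pose B := \max_i j i.
have szs : size s = k by rewrite size_sort size_codom card_ord.
have us : sorted ltn s.
  rewrite ltn_sorted_uniq_leq sort_uniq sort_sorted ?andbT; last exact: leq_total.
  by apply/injectiveP.
have sj l : l < k -> exists i, nth 0 s l = j i.
  move=> lk; have : nth 0 s l \in codom j by rewrite -(mem_sort leq) mem_nth ?szs.
  by move=> /codomP.
(* Beyond [k] the values only have to increase and to exceed the maximum [B]. *)
exists (fun l => if l < k then nth 0 s l else B + l.+1) => [l l' ll'|l lk]; last first.
  by rewrite lk; apply: sj.
case: ifP => [lk|nlk]; case: ifP => [l'k|nl'k].
- by apply: (sorted_ltn_nth ltn_trans) => //; rewrite inE szs.
- have [i ->] := sj l lk; rewrite addnS ltnS; apply: leq_trans (leq_addr _ _).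
  exact: leq_bigmax.
- by move: (ltn_trans ll' l'k); rewrite nlk.
- by rewrite ltn_add2l.
Qed.

Section Indiscernibles.
Context (L : language) (M : structure L) (K : Type).
Hypothesis sat_M : saturated M K.
Hypothesis hom_M : strongly_homogeneous M K.
Hypothesis small_countable :
  forall A B : set M, small K A -> countable B -> small K (A `|` B).
Implicit Types (A B C D E N : set M).

Definition subseq_of W (s : nat * W -> M) (g : nat -> nat) p := s (g p.1, p.2).

(* For finite tuples this is [indiscernible], stated by comparison with the subsequences of [s]. *)
Definition indisc A W (s : nat * W -> M) := forall P, definable A P ->
  forall g, incr g -> P (subseq_of s g) <-> P s.

(** Extraction of indiscernibles: [s'] is asked to be indiscernible and to satisfy all that holds on
    every subsequence of [s]. Ramsey's theorem meets any finite part of this on a subsequence. *)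
Lemma ramsey_transfer A (W : countType) (s : nat * W -> M) : small K A ->
  exists2 s', indisc A s' & forall P, definable A P -> P s' ->
    exists2 g, incr g & P (subseq_of s g).
Proof.
move=> sA.
pose F (P : (nat * W -> M) -> Prop) :=
  (definable A P /\ forall g, incr g -> P (subseq_of s g)) \/
  (exists Q g, [/\ definable A Q, incr g & P = fun u => Q (subseq_of u g) <-> Q u]).
have Dsub Q g : definable A Q -> definable A (fun u : nat * W -> M => Q (subseq_of u g)).
  by move=> QD; apply: (definable_coord _ QD) => w; left; exists (g w.1, w.2).
have [P|ps psF|s' s'F] := realize sat_M small_countable (F := F) sA.
- case=> [[]//|[Q [g [QD gI ->]]]].
  by apply: definable_and; apply: definable_imp => //; apply: Dsub.
- suff [Qs QsD QsP] : exists2 Qs : seq ((nat * W -> M) -> Prop),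
      forall Q, List.In Q Qs -> definable A Q &
      forall g, incr g -> (forall Q, List.In Q Qs -> forall g', incr g' ->
        Q (subseq_of s (g \o g')) <-> Q (subseq_of s g)) -> satisfies ps (subseq_of s g).
    have [|g gI gP] := @ramsey_list [seq (fun h => Q (subseq_of s h)) | Q <- Qs].
      move=> P /List.in_map_iff [Q [<- /QsD QD]].
      have [n nP] := definable_finsupp (fun p => p.1) QD.
      by exists n => h h' hh; apply: nP => p /hh; rewrite /subseq_of => ->.
    exists (subseq_of s g); apply: QsP => // Q QQs g' g'I.
    apply: (gP (fun h => Q (subseq_of s h)) _ g' id) => //.
    by apply/List.in_map_iff; exists Q.
  elim: ps psF => [|P ps IH] psF; first by exists nil => // g _ _ P [].
  have [|Qs QsD QsP] := IH; first by move=> Q Qps; apply: psF; right.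
  have [[PD Ps]|[Q [g [QD gI PE]]]] := psF P (or_introl erefl).
    by exists Qs => // g gI gP Q /= [<-|]; [apply: Ps|apply: QsP].
  exists (Q :: Qs) => [Q' /= [<-//|/QsD//]|g' g'I g'P P' /= [<-|]].
    by rewrite PE; apply: (g'P Q (or_introl erefl) g).
  by apply: QsP => // Q' Q'Qs; apply: g'P; right.
exists s' => [P PD g gI|P PD Ps'].
  by apply: (s'F (fun u => P (subseq_of u g) <-> P u)); right; exists P, g.
apply: contrapT => nP; apply: (s'F (fun u => ~ P u)) Ps'; left.
by split=> [|g gI Pg]; [apply: definable_not|apply: nP; exists g].
Qed.

End Indiscernibles.

(** * Kim's lemma *)

Section Kim.
Context (L : language) (M : structure L) (K : Type).
Hypothesis sat_M : saturated M K.
Hypothesis hom_M : strongly_homogeneous M K.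
Hypothesis small_countable :
  forall A B : set M, small K A -> countable B -> small K (A `|` B).
Hypothesis ntp2 : NTP2 M.
Implicit Types (A B C D E N : set M).

Definition row W (u : nat * W -> M) i := fun w => u (i, w).

Lemma definable_row A W (P : (W -> M) -> Prop) i :
  definable A P -> definable A (fun u : nat * W -> M => P (row u i)).
Proof. by move=> PD; apply: definable_coord PD => w; left; exists (i, w). Qed.

Lemma definable_common A Z W (I : finType) (R : (Z + W -> M) -> Prop) (j : I -> nat) :
  definable A R ->
  definable A (fun u : nat * W -> M => exists x, forall i, R (sumf x (row u (j i)))).
Proof.
move=> RD; apply: (@definable_ex _ _ _ _ Z (fun v => forall i,
  R (sumf (v \o inr) (fun w => v (inl (j i, w)))))).
apply: definable_all_fin => i; apply: (definable_coord
  (F := fun v => sumf (v \o inr) (fun w => v (inl (j i, w)))) _ RD).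
by move=> [z|w]; left; [exists (inr z)|exists (inl (j i, w))].
Qed.

Lemma indisc_row A (W : countType) (u : nat * W -> M) i : small K A -> indisc A u ->
  exists2 s, aut A s & row u i = s \o row u 0.
Proof.
move=> sA uI.
have [|s sAut su] := homogeneity hom_M small_countable (a := row u 0) (b := row u i) sA.
  move=> P PD P0; have addI : incr (addn i) by move=> x y; rewrite ltn_add2l.
  have := (uI _ (definable_row 0 PD) _ addI).2 P0.
  by rewrite /row /subseq_of /= addn0.
by exists s.
Qed.

Lemma dividing_indiscernible A Z (W : countType) (R : (Z + W -> M) -> Prop) b :
  small K A -> definable A R -> dividing A (fun x => R (sumf x b)) ->
  exists k u, [/\ indisc A u, exists2 s, aut A s & row u 0 = s \o b &
    forall j : 'I_k -> nat, injective j ->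
      ~ exists x, forall i, R (sumf x (row u (j i)))].
Proof.
move=> sA RD /(dividing_witness RD) [k [t [tA tR]]].
pose v (p : nat * W) := t p.1 (b p.2).
have [u uI uv] := ramsey_transfer sat_M small_countable v sA.
exists k, u; split=> //.
  have [|s sAut su] := homogeneity hom_M small_countable (a := b) (b := row u 0) sA.
    move=> P PD Pb; apply: contrapT => nP.
    have [g _ []] := uv _ (definable_not (definable_row 0 PD)) nP.
    exact: (aut_same_type (tA (g 0)) PD Pb).
  by exists s.
move=> j jI /(uv _ (definable_common j RD)) [g gI [x xP]].
apply: (tR id (aut_id _) (g \o j)); first by apply: inj_comp jI; apply: incr_inj.
by exists x.
Qed.

(** Otherwise compactness gives [g] true of [u] and [Q] true of [b] such that no sequence satisfying
    [g] has its first [n] rows in [Q]. Adding this failure to [Q] gives a formula, true of a tuple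
    of [D] and [b], that divides along [u]. *)
Lemma indiscernible_shift A D (W : countType) (b : W -> M) u : small K (A `|` D) ->
  indisc A u -> (exists2 s, aut A s & row u 0 = s \o b) -> nondividing A D b ->
  exists2 t, aut A t & forall l, exists2 s, aut (A `|` D) s & t \o row u l = s \o b.
Proof.
move=> sAD uI [s0 s0A us0] ndb.
have sA : small K A by apply: small_sub sAD; apply: subsetUl.
pose F (P : (nat * W -> M) -> Prop) := (definable A P /\ P u) \/
  (exists Q l, [/\ definable (A `|` D) Q, Q b & P = (fun v => Q (row v l))]).
have [P|ps psF|v vF] := realize sat_M small_countable (F := F) sAD.
- case=> [[PD _]|[Q [l [QD _ ->]]]]; last exact: definable_row.
  by apply: definable_sub PD; apply: subsetUl.
- have [g [Q [n [gD gu QD Qb gQ]]]] : exists g Q n, [/\ definable A g, g u,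
      definable (A `|` D) Q, Q b &
      forall v, g v -> (forall l, l < n -> Q (row v l)) -> satisfies ps v].
    elim: ps psF => [|P ps IH] psF.
      exists (fun=> True), (fun=> True), 0; split=> //; try exact: definable_true.
      by move=> v _ _ P [].
    have [|g [Q [n [gD gu QD Qb gQ]]]] := IH; first by move=> P' P'ps; apply: psF; right.
    have [[PD Pu]|[Q' [l [Q'D Q'b PE]]]] := psF P (or_introl erefl).
      exists (fun v => g v /\ P v), Q, n; split=> //; first exact: definable_and.
      by move=> v [gv Pv] Qv P' /= [<-//|]; apply: gQ.
    exists g, (fun x => Q x /\ Q' x), (maxn n l.+1); split=> //; first exact: definable_and.
    move=> v gv Qv P' /= [<-|].
      by rewrite PE; apply: (Qv l _).2; rewrite leq_max ltnSn orbT.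
    by apply: gQ => // i lt; apply: (Qv i _).1; rewrite leq_max lt.
  apply: contrapT => /forallNP nsat.
  have [k [e [Q1 [eD Q1D QQ1]]]] := definable_split QD.
  pose eta (z : 'I_k -> M) := exists v, g v /\ forall l, l < n -> Q1 (sumf z (row v l)).
  have etaD : definable A eta.
    apply: (@definable_ex _ _ _ _ (nat * W)%type (fun v => g (v \o inr) /\ forall l, l < n ->
      Q1 (sumf (v \o inl) (fun w => v (inr (l, w)))))).
    apply: definable_and; first exact: definable_reindex.
    apply: definable_forall_lt => l _; apply: (definable_coord
      (F := fun v => sumf (v \o inl) (fun w => v (inr (l, w)))) _ Q1D).
    by move=> [z|w]; left; [exists (inl z)|exists (inr (l, w))].
  have neta : ~ eta e.
    move=> [v [gv Qv]]; apply: (nsat v); apply: gQ => // l lt.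
    by apply/QQ1; apply: Qv.
  (* A common solution of [Q2] on the first [n.+1] rows of [u] satisfies [eta], with [u] itself as
     witness, while row 0 denies it. *)
  pose Q2 (v : 'I_k + W -> M) := Q1 v /\ ~ eta (v \o inl).
  have Q2D : definable A Q2 by apply: definable_and => //; apply/definable_not/definable_reindex.
  apply: (ndb k e Q2 eD Q2D); first by split=> //; apply/QQ1.
  have /choice[s sP] : forall l, exists s, aut A s /\ row u l = s \o b.
    move=> l; have [s sAut sl] := indisc_row l sA uI.
    by exists (s \o s0); split; [apply: aut_comp|rewrite sl us0].
  have /choice[t tP] : forall l, exists t, [/\ aut A t, cancel (s l) t & cancel t (s l)].
    by move=> l; apply: aut_inv; case: (sP l).
  exists n.+1, t; split=> [l|j jI [x xP]]; first by case: (tP l).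
  have {}xP i : Q2 (sumf x (row u (j i))).
    have [sA' ->] := sP (j i); have [tA sK tK] := tP (j i).
    by have := xP i; rewrite (aut_sumfl _ _ tA sA').
  have [h hI hj] := incr_enum jI.
  have [x' x'P] : exists x, forall i : 'I_n.+1, Q2 (sumf x (row u i)).
    apply: (iffLR (uI _ (definable_common (fun i : 'I_n.+1 => i : nat) Q2D) h hI)).
    exists x => i; have [i' hi] := hj i (ltn_ord i).
    by rewrite /row /subseq_of /= hi; apply: xP.
  apply: (x'P ord0).2; exists u; split=> // l lt.
  exact: (x'P (Ordinal (ltnW lt : l < n.+1))).1.
have [|t tA tu] := homogeneity hom_M small_countable (a := u) (b := v) sA.
  by move=> P PD Pu; apply: vF; left.
exists t => // l; have -> : t \o row u l = row v l by rewrite -tu.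
have [|s sAD' sb] := homogeneity hom_M small_countable (a := b) (b := row v l) sAD.
  by move=> Q QD Qb; apply: (vF (fun v => Q (row v l))); right; exists Q, l.
by exists s.
Qed.

(* If each [v n] has the type of [u n] over [N] and the earlier terms, and that type is
   finitely satisfiable in [N], then [u] may be replaced by [v] one term at a time. *)
Lemma path_same_type N W (u v : nat -> W -> M) (D : nat -> set M) :
  elementary N ->
  (forall i n w, i < n -> D n (u i w)) -> (forall i n w, i < n -> D n (v i w)) ->
  (forall n, coheir N (range (v n)) (D n)) -> (forall n, same_type (N `|` D n) (u n) (v n)) ->
  forall P : (nat * W -> M) -> Prop, definable N P ->
    P (fun p => u p.1 p.2) -> P (fun p => v p.1 p.2).
Proof.
move=> elem_N uD vD cohv uv.
have [m0] := Defs.nonempty M.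
have [c Nc _] := elementary_witness elem_N (u := fun _ : unit => m0) (definable_true N unit) I.
(* Filling up with a constant of [N] leaves finitely many terms to exchange and keeps all values in
   [D n] and [N]. *)
pose trunc n (f : nat -> W -> M) (p : nat * W) := if p.1 < n then f p.1 p.2 else c tt.
have trP n P : definable N P -> P (trunc n u) -> P (trunc n v).
  elim: n P => [|n IH] P PD Pu.
    by have -> : trunc 0 v = trunc 0 u by [].
  pose P1 (y : W -> M) := P (fun p => if p.1 < n then u p.1 p.2 else
    if p.1 == n then y p.2 else c tt).
  have P1D : definable (N `|` D n) P1.
    apply: (definable_coord (F := fun y p => if p.1 < n then u p.1 p.2 else
      if p.1 == n then y p.2 else c tt) _ (definable_sub _ PD)); last by move=> x; left.
    move=> [i w] /=; case lt: (i < n); first by right; exists (u i w) => //; right; apply: uD.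
    by case: (i == n); [left; exists w|right; exists (c tt) => //; left].
  pose P2 (y : nat * W -> M) := P (fun p => if p.1 < n then y p else
    if p.1 == n then v n p.2 else c tt).
  have P2D : definable (N `|` range (v n)) P2.
    apply: (definable_coord (F := fun y p => if p.1 < n then y p else
      if p.1 == n then v n p.2 else c tt) _ (definable_sub _ PD)); last by move=> x; left.
    move=> [i w] /=; case lt: (i < n); first by left; exists (i, w).
    by case: (i == n); right; [exists (v n w) => //; right; exists w|exists (c tt) => //; left].
  have P1u : P1 (u n).
    congr P : Pu; apply: funext => -[i w]; rewrite /trunc /= [i < n.+1]ltnS [i <= n]leq_eqVlt.
    by case: ltngtP => //= ->.
  have P2u : P2 (trunc n u).
    congr P : (uv n _ P1D P1u); apply: funext => -[i w]; rewrite /trunc /=.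
    by case: ifP.
  (* By induction [trunc n u] and [trunc n v] have the same type over [N]; the coheir [v n] cannot
     tell them apart. *)
  have P2v : P2 (trunc n v).
    have tD f : (forall i m w, i < m -> D m (f i w)) -> forall p, (D n `|` N) (trunc n f p).
      by move=> fD [i w]; rewrite /trunc /=; case: ifP => lt; [left; apply: fD|right].
    apply: (@coheir_same_type _ _ N (range (v n)) (D n `|` N) _ (trunc n u) (trunc n v))
      P2D P2u => //.
    - by apply: coheir_sub (cohv n) => // x [|]; [right|left].
    - exact: tD.
    - exact: tD.
  congr P : P2v; apply: funext => -[i w]; rewrite /trunc /= [i < n.+1]ltnS [i <= n]leq_eqVlt.
  by case: ltngtP => //= ->.
move=> P PD Pu; have [n nP] := definable_finsupp (fun p => p.1) PD.
have trE f : P (trunc n f) <-> P (fun p => f p.1 p.2).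
  by apply: nP => p; rewrite /trunc => ->.
exact: (iffLR (trE v) (trP n P PD (iffRL (trE u) Pu))).
Qed.

End Kim.

(** * Dividing is closed under finite unions over an elementary submodel *)

Lemma inconsistentU T (X Y : nat -> T -> Prop) r r' :
  (forall S : 'I_r -> nat, injective S -> ~ exists x, forall l, X (S l) x) ->
  (forall S : 'I_r' -> nat, injective S -> ~ exists x, forall l, Y (S l) x) ->
  forall S : 'I_(r + r') -> nat, injective S ->
    ~ exists x, forall l, X (S l) x \/ Y (S l) x.
Proof.
move=> Xr Yr' S SI [x xP].
pose c l := `[< X (S l) x >].
have pick m (A : {pred 'I_(r + r')}) : m <= #|A| -> exists2 h : 'I_m -> 'I_(r + r'),
    injective h & forall l, h l \in A.
  move=> mA; exists (fun l => enum_val (widen_ord mA l)); last by move=> l; apply: enum_valP.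
  by move=> l l' /enum_val_inj /(congr1 val) /= /ord_inj.
(* Pigeonhole: [X] holds at [r] indices or fails at [r'] of them. *)
have [rc|cr] := leqP r #|c|.
  have [h hI hc] := pick r c rc.
  apply: (Xr (S \o h)); first exact: inj_comp.
  by exists x => l; have := hc l; rewrite -topredE /= => /asboolP.
have [|h hI hc] := pick r' [predC c].
  by have := cardC c; rewrite card_ord => e; rewrite -(leq_add2l #|c|) e leq_add2r ltnW.
apply: (Yr' (S \o h)); first exact: inj_comp.
exists x => l; have := hc l; rewrite !inE -topredE /= => /asboolPn nX.
by case: (xP (h l)).
Qed.

Section Forking.
Context (L : language) (M : structure L) (K : Type).
Hypothesis sat_M : saturated M K.
Hypothesis hom_M : strongly_homogeneous M K.
Hypothesis small_countable :
  forall A B : set M, small K A -> countable B -> small K (A `|` B).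
Hypothesis ntp2 : NTP2 M.
Implicit Types (A B C D E N : set M).

Lemma dividing_conj A Z W (R : (Z + W -> M) -> Prop) b s : aut A s -> definable A R ->
  dividing A (fun x => R (sumf x b)) -> dividing A (fun x => R (sumf x (s \o b))).
Proof.
move=> sA RD dv; have [t [tA sK tK]] := aut_inv sA.
by have := dividing_aut tA dv; apply: dividing_sub => x; rewrite (aut_sumfl _ _ tA sA).
Qed.

(* The Kim lemma of NTP2 theories: dividing over [N] is witnessed along any sequence of
   copies of [b] that are strictly nonforking over the earlier rows. Each copy starts a row
   indiscernible over these, and by [path_same_type] all paths have the type of the sequence. *)
Lemma kim_rows N Z (W : countType) (b : W -> M) n (R : nat -> (Z + W -> M) -> Prop)
    (good : set M -> (M -> M) -> Prop) :
  small K N -> elementary N ->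
  (forall D, countable D -> exists s, good D s) ->
  (forall D s, good D s -> [/\ aut N s, coheir N (range (s \o b)) D & nondividing N D (s \o b)]) ->
  (forall i, i < n -> definable N (R i) /\ dividing N (fun x => R i (sumf x b))) ->
  exists (s : nat -> M -> M) (D : nat -> set M),
    [/\ forall p, good (D p) (s p),
        forall p q, p < q -> range (s p \o b) `<=` D q &
        forall i, i < n -> exists r, forall S : 'I_r -> nat, injective S ->
          ~ exists x, forall l, R i (sumf x (s (S l) \o b))].
Proof.
move=> small_N elem_N good_ex goodP RP.
have /choice[k kP] : forall i, exists k, i < n -> exists u, [/\ indisc N u,
    exists2 s, aut N s & row u 0 = s \o b &
    forall j : 'I_k -> nat, injective j -> ~ exists x, forall l, R i (sumf x (row u (j l)))].
  move=> i; have [lt|_] := boolP (i < n); last by exists 0.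
  have [RD Rdiv] := RP i lt.
  have [k [u uP]] := dividing_indiscernible sat_M hom_M small_countable small_N RD Rdiv.
  by exists k => _; exists u.
have [m0] := Defs.nonempty M.
have /choice[u uP] : forall i, exists u, i < n -> [/\ indisc N u,
    exists2 s, aut N s & row u 0 = s \o b &
    forall j : 'I_(k i) -> nat, injective j -> ~ exists x, forall l, R i (sumf x (row u (j l)))].
  move=> i; have [lt|_] := boolP (i < n); last by exists (fun=> m0).
  by have [u' ?] := kP i lt; exists u'.
have /choice[nxt nxtP] : forall D, exists st : (M -> M) * (nat -> M -> M), countable D ->
    good D st.1 /\ forall i, i < n -> aut N (st.2 i) /\
      forall l, exists2 s, aut (N `|` D) s & st.2 i \o row (u i) l = s \o (st.1 \o b).
  move=> D; have [cD|] := pselect (countable D); last by exists (id, fun=> id).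
  have [s sg] := good_ex D cD; have [sN cohs nds] := goodP D s sg.
  have /choice[t tP] : forall i, exists t, i < n -> aut N t /\
      forall l, exists2 s', aut (N `|` D) s' & t \o row (u i) l = s' \o (s \o b).
    move=> i; have [lt|_] := boolP (i < n); last by exists id.
    have [uI [s' s'N us'] _] := uP i lt; have [s1 [s1N sK s1K]] := aut_inv sN.
    have [|t tN tP] := indiscernible_shift sat_M hom_M small_countable
      (small_countable small_N cD) uI _ nds; last by exists t.
    exists (s' \o s1); first exact: aut_comp.
    by rewrite us'; apply: funext => w /=; rewrite sK.
  by exists (s, t).
(* [D p] contains the indiscernible rows attached to the earlier copies as well, for every [i],
   because [path_same_type] needs both sequences inside it. *)
pose D p := iter p (fun D => D `|` (range ((nxt D).1 \o b) `|`
  range (fun q : nat * (nat * W) => (nxt D).2 q.1 (u q.1 q.2)))) set0.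
have cD p : countable (D p).
  elim: p => [|p IH]; first exact: countable0.
  by apply: countable_setU => //; apply: countable_setU; apply: countable_range_fun.
have DD p q : p < q -> range ((nxt (D p)).1 \o b) `|`
  range (fun q : nat * (nat * W) => (nxt (D p)).2 q.1 (u q.1 q.2)) `<=` D q.
  elim: q => // q IH; rewrite ltnS leq_eqVlt => /orP[/eqP->|/IH h] x xP; first by right.
  by left; apply: h.
exists (fun p => (nxt (D p)).1), D; split=> [p|p q pq|i lt].
- by case: (nxtP _ (cD p)).
- by apply: subset_trans (DD p q pq); apply: subsetUl.
have [RD Rdiv] := RP i lt; have [uI _ uR] := uP i lt.
have [r rP] := NTP2_rows sat_M small_countable ntp2 (k i) small_N RD.
exists r => S SI.
pose t p := (nxt (D p)).2 i.
have tP p : aut N (t p) /\ forall l, exists2 s, aut (N `|` D p) s &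
    t p \o row (u i) l = s \o ((nxt (D p)).1 \o b).
  by have [_ /(_ i lt)] := nxtP _ (cD p).
pose S' m := if insub m is Some l then S l else 0.
have [|f fP] := rP (fun m j => t (S' m) \o row (u i) j).
  move=> m mr j jI [x xP].
  have [t' [t'N tK t'K]] := aut_inv (tP (S' m)).1.
  apply: (uR j jI); exists (t' \o x) => l.
  by rewrite (aut_sumfl _ _ t'N (tP (S' m)).1).
(* The path [f] is indexed by rows, that is by positions in [S]; [F] indexes the same choice by
   copies. *)
have /choice[F FP] : forall p, exists m, forall l : 'I_r, S l = p -> m = f l.
  move=> p; have [[l <-]|nl] := pselect (exists l, S l = p).
    by exists (f l) => l' /SI ->.
  by exists 0 => l lp; case: nl; exists l.
have path P : definable N P -> P (fun p => (t p.1 \o row (u i) (F p.1)) p.2) ->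
    P (fun p => ((nxt (D p.1)).1 \o b) p.2).
  apply: (path_same_type (D := D) (u := fun p => t p \o row (u i) (F p))
    (v := fun p => (nxt (D p)).1 \o b)) => //.
  - by move=> p q w pq; apply: DD pq _ _; right; exists (i, (F p, w)).
  - by move=> p q w pq; apply: DD pq _ _; left; exists w.
  - by move=> p; have [/goodP[]] := nxtP _ (cD p).
  - move=> p; have [_ /(_ (F p)) [s sD ->]] := tP p.
    by apply: same_type_sym; apply: aut_same_type.
have := path _ (definable_not (definable_common S RD)); apply.
move=> [x xP]; apply: fP; exists x => m mr.
have -> : S' m = S (Ordinal mr).
  by rewrite /S' (insubT (fun m => m < r) mr).
by have := xP (Ordinal mr); rewrite /row /= (FP _ (Ordinal mr) erefl).
Qed.

(** Kim's lemma provides one sequence of copies for all [R i], so that their bounds of inconsistency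
    can be added up. *)
Lemma dividing_union_elementary N Z (W : countType) (b : W -> M) n
    (R : nat -> (Z + W -> M) -> Prop) :
  small K N -> elementary N ->
  (forall i, i < n -> definable N (R i) /\ dividing N (fun x => R i (sumf x b))) ->
  dividing N (fun x => exists2 i, i < n & R i (sumf x b)).
Proof.
move=> small_N elem_N RP.
have [||s [D [sP _ sR]]] := @kim_rows N Z W b n R
  (fun D s => [/\ aut N s, coheir N (range (s \o b)) D & nondividing N D (s \o b)])
  small_N elem_N _ _ RP.
- by move=> D cD; apply: (strict_copy sat_M hom_M small_countable ntp2).
- by [].
have /choice[t tP] : forall p, exists t, [/\ aut N t, cancel (s p) t & cancel t (s p)].
  by move=> p; apply: aut_inv; case: (sP p).
suff [r rP] : exists r, forall S : 'I_r -> nat, injective S ->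
    ~ exists x, forall l, exists2 i, i < n & R i (sumf x (s (S l) \o b)).
  exists r, t; split=> [p|S SI [x xP]]; first by case: (tP p).
  apply: (rP S SI); exists x => l; have [i lt Ri] := xP l; exists i => //.
  have [RD _] := RP i lt; have [sN _ _] := sP (S l); have [tN sK tK] := tP (S l).
  by move: Ri; rewrite (aut_sumfl _ _ tN sN).
elim: n R RP sR => [|n IH] R RP sR; first by exists 1 => S _ [x /(_ ord0) []].
have [||r rP] := IH R; first by move=> i lt; apply/RP/ltnW.
  by move=> i lt; apply/sR/ltnW.
have [r' r'P] := sR n (ltnSn n).
exists (r + r') => S SI [x xP].
apply: (@inconsistentU _ (fun p x => exists2 i, i < n & R i (sumf x (s p \o b)))
  (fun p x => R n (sumf x (s p \o b))) _ _ rP r'P S SI); exists x => l.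
have [i] := xP l; rewrite ltnS leq_eqVlt => /orP[/eqP-> ?|? ?]; first by right.
by left; exists i.
Qed.

(** Extraction over [A] and [D] keeps the type over [A], as [u] is indiscernible there. A dividing
    formula true of the new sequence would be true of a subsequence of [u], which is a conjugate of
    [u]. The last clause lets coheirs be inherited. *)
Lemma indiscernible_nondividing A D (W : countType) (u : nat * W -> M) :
  small K (A `|` D) -> indisc A u -> nondividing A D u ->
  exists s, [/\ aut A s, indisc (A `|` D) (s \o u), nondividing A D (s \o u) &
    forall P, definable (A `|` D) P -> P (s \o u) -> exists2 g, incr g & P (subseq_of u g)].
Proof.
move=> sAD uI ndu; have sA : small K A by apply: small_sub sAD; apply: subsetUl.
have [v vI vP] := ramsey_transfer sat_M small_countable u sAD.
have [|s sAut su] := homogeneity hom_M small_countable (a := u) (b := v) sA.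
  move=> P PD Pu; apply: contrapT => nP.
  have [|g gI []] := vP (fun y => ~ P y) _ nP; last exact/(uI _ PD).
  by apply: definable_not; apply: definable_sub PD; apply: subsetUl.
exists s; rewrite su; split=> // k e Q eD QD Qv dv.
have [|g gI Qg] := vP (fun y => Q (sumf e y)) _ Qv.
  apply: (definable_coord (F := fun y => sumf e y) _ (definable_sub _ QD)); last by move=> x; left.
  by move=> [i|w]; [right; exists (e i) => //; right|left; exists w].
pose Q' (y : 'I_k + nat * W -> M) := Q (sumf (y \o inl) (subseq_of (y \o inr) g)).
have Q'D : definable A Q'.
  apply: (definable_coord (F := fun y => sumf (y \o inl) (subseq_of (y \o inr) g)) _ QD).
  by move=> [i|w]; left; [exists (inl i)|exists (inr (g w.1, w.2))].
apply: (ndu k e Q' eD Q'D Qg).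
have [|s' s'A s'u] := homogeneity hom_M small_countable (a := u) (b := subseq_of u g) sA.
  by move=> P PD Pu; apply/(uI _ PD).
have [t [tA sK tK]] := aut_inv sAut.
have := dividing_conj (aut_comp s'A tA) QD dv.
have -> // : (s' \o t) \o v = subseq_of u g.
by rewrite -su -s'u; apply: funext => w /=; rewrite sK.
Qed.

End Forking.

(** * The chain condition over an elementary submodel *)

Section Chain.
Context (L : language) (M : structure L) (K : Type).
Hypothesis sat_M : saturated M K.
Hypothesis hom_M : strongly_homogeneous M K.
Hypothesis small_countable :
  forall A B : set M, small K A -> countable B -> small K (A `|` B).
Hypothesis ntp2 : NTP2 M.
Implicit Types (A B C D E N : set M).

Lemma indisc_aut A W (u : nat * W -> M) s : aut A s -> indisc A u -> indisc A (s \o u).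
Proof.
move=> sA uI P PD g gI; rewrite (aut_definable _ sA PD).
by rewrite -(uI _ PD g gI); apply: (aut_definable _ sA PD).
Qed.

Lemma incr_two i j : i < j -> exists2 g, incr g & g 0 = i /\ g 1 = j.
Proof.
move=> ij; exists (fun n => if n is n'.+1 then j + n' else i); last by rewrite addn0.
apply: incrW => -[|n] /=; first by rewrite addn0.
by rewrite addnS.
Qed.

(* Write [a p i] for the i-th term of the p-th copy of [u]. The pairs [a p 0, a p 1] witness
   that [R(x, u 0) /\ R(x, u 1)] divides, so no [x] satisfies two terms in each of [r] copies.
   If [R(x, u 0)] did not divide, one term in each copy could be satisfied simultaneously.
   Grouping the copies in blocks of [r] and letting the i-th entry of row [t] be the
   conjunction of the [R(x, a p i)] over the copies [p] in block [t] then gives 2-inconsistent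
   rows all of whose paths are consistent. *)
Lemma chain_elementary N Z (W : countType) (R : (Z + W -> M) -> Prop) u :
  small K N -> elementary N -> definable N R -> indisc N u ->
  dividing N (fun x => R (sumf x (row u 0)) /\ R (sumf x (row u 1))) ->
  dividing N (fun x => R (sumf x (row u 0))).
Proof.
move=> small_N elem_N RD uI dv; apply: contrapT => ndv.
have smallND D : countable D -> small K (N `|` D) by move=> cD; apply: small_countable.
(* Indiscernibility over the earlier copies is added in order to change columns in one copy at a
   time. *)
pose good D s := [/\ aut N s, coheir N (range (s \o u)) D, nondividing N D (s \o u) &
  indisc (N `|` D) (s \o u)].
pose R2 (y : Z + nat * W -> M) :=
  R (sumf (y \o inl) (row (y \o inr) 0)) /\ R (sumf (y \o inl) (row (y \o inr) 1)).
have R2D : definable N R2.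
  by apply: definable_and;
    apply: (definable_coord (F := fun y => sumf (y \o inl) (row (y \o inr) _)) _ RD);
    move=> [z|w]; left; eexists.
have [||i|s [D [sP sD sR]]] := @kim_rows _ _ _ sat_M hom_M small_countable ntp2
  N Z (nat * W)%type u 1 (fun=> R2) good small_N elem_N.
- move=> D cD.
  have [s [sN cohs nds]] := strict_copy sat_M hom_M small_countable ntp2 u small_N elem_N cD.
  have [t [tN tI ndt tP]] := indiscernible_nondividing sat_M hom_M small_countable (smallND D cD)
    (indisc_aut sN uI) nds.
  exists (t \o s); split=> //; first exact: aut_comp.
  (* A formula true of the extracted sequence is true of a subsequence of [s \o u], hence satisfied
     in [N]. *)
  move=> V P v PD vr Pv.
  have /choice[h hP] : forall x, exists w, t (s (u w)) = v x.
    by move=> x; have [w _ wx] := vr x; exists w.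
  have [||g gI Pg] := tP (fun y => P (y \o h)).
  + exact: definable_reindex.
  + by have -> : (t \o (s \o u)) \o h = v by apply: funext => x /=.
  apply: (cohs V P _ PD _ Pg) => x; by exists (g (h x).1, (h x).2).
- by move=> D s [].
- by move=> _; split=> //; apply: dv.
have [r rP] := sR 0 (ltn0Sn 0).
pose Phi (y : Z + 'I_r * W -> M) := forall c : 'I_r,
  R (sumf (y \o inl) (fun w => y (inr (c, w)))).
have PhiD : definable N Phi.
  apply: definable_all_fin => c.
  apply: (definable_coord (F := fun y => sumf (y \o inl) (fun w => y (inr (c, w)))) _ RD).
  by move=> [z|w]; left; [exists (inl z)|exists (inr (c, w))].
have [T TP] := NTP2_rows sat_M small_countable ntp2 2 small_N PhiD.
have /choice[t tP] : forall p, exists t, [/\ aut N t, cancel (s p) t & cancel t (s p)].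
  by move=> p; apply: aut_inv; case: (sP p).
pose q := T * r.
(* If any [q.+1] copies were inconsistent, the copies would witness dividing of [R (x, u 0)]. The
   number [q] counts [T] rows with [r] copies in each. *)
have [S SI [x xP]] : exists2 S : 'I_q.+1 -> nat, injective S &
    exists x, forall l, R (sumf x (s (S l) \o row u 0)).
  apply: contrapT => nS; apply: ndv; exists q.+1, t; split=> [p|S SI [x xP]].
    by case: (tP p).
  apply: nS; exists S => //; exists x => l; have [tN sK tK] := tP (S l).
  have [sN _ _ _] := sP (S l).
  by have := xP l; rewrite (aut_sumfl _ _ tN sN).
pose S' m := S (inord m).
have S'I m m' : m < q.+1 -> m' < q.+1 -> S' m = S' m' -> m = m'.
  by move=> lm lm' /SI /(congr1 val); rewrite /= !inordK.
have path V (f g : nat -> V -> nat * W) :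
    (forall p, same_type (N `|` D p) (s p \o u \o f p) (s p \o u \o g p)) ->
    forall P, definable N P ->
      P (fun y => s y.1 (u (f y.1 y.2))) -> P (fun y => s y.1 (u (g y.1 y.2))).
  move=> fg; apply: (path_same_type (D := D) (u := fun p => s p \o u \o f p)
    (v := fun p => s p \o u \o g p)) => //.
  - by move=> p p' v pp'; apply: (sD p p' pp'); exists (f p v).
  - by move=> p p' v pp'; apply: (sD p p' pp'); exists (g p v).
  - move=> p; have [_ c _ _] := sP p; apply: coheir_sub c => // _ [v _ <-].
    by exists (g p v).
have tr_lt t' l : t' < T -> l < r -> t' * r + l < q.
  move=> tT lr; rewrite /q; apply: (@leq_trans (t'.+1 * r)); last by rewrite leq_mul2r tT orbT.
  by rewrite mulSn addnC ltn_add2r.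
have [|f] := TP (fun t' i y => s (S' (t' * r + y.1)) (u (i, y.2))).
  move=> t' tT j jI [x' x'P].
  (* Exchanging columns copy by copy turns a common solution at columns [i] and [i'] into one at
     columns 0 and 1 of [r] copies. *)
  have key : forall i i', i < i' -> (exists x', forall c : 'I_r,
      R (sumf x' (s (S' (t' * r + c)) \o row u i)) /\
      R (sumf x' (s (S' (t' * r + c)) \o row u i'))) -> False.
    move=> i i' ii' [y yP].
    have [g gI [g0 g1]] := incr_two ii'.
    pose ff (a b : nat) (p : nat) (y : bool * W) := (if y.1 then a else b, y.2).
    have fg p : same_type (N `|` D p) (s p \o u \o ff i i' p) (s p \o u \o ff 0 1 p).
      move=> P PD Pi; have [_ _ _ sI] := sP p.
      apply: (iffLR (sI (fun y => P (y \o ff 0 1 p)) (definable_reindex _ PD) g gI)).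
      congr P : Pi; apply: funext => -[[] w]; by rewrite /subseq_of /= ?g0 ?g1.
    pose P (y : nat * (bool * W) -> M) := exists x, forall c : 'I_r * bool,
      R (sumf x (row (fun p => y (p.1, (c.2, p.2))) (S' (t' * r + c.1)))).
    have PD : definable N P.
      apply: (@definable_ex _ _ _ _ Z (fun v => forall c : 'I_r * bool,
        R (sumf (v \o inr) (fun w => v (inl (S' (t' * r + c.1), (c.2, w))))))).
      apply: definable_all_fin => c; apply: (definable_coord (F := fun v => sumf (v \o inr)
        (fun w => v (inl (S' (t' * r + c.1), (c.2, w))))) _ RD).
      by move=> [z|w]; left; [exists (inr z)|exists (inl (S' (t' * r + c.1), (c.2, w)))].
    have [|x0 x0P] := path _ _ _ fg P PD.
      by exists y => -[c []]; have [] := yP c.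
    apply: (rP (fun l => S' (t' * r + l))).
      move=> l l' /S'I h; apply: ord_inj; apply/(@addnI (t' * r))/h; apply: ltnW;
      by rewrite ltnS tr_lt.
    by exists x0 => l; split; [apply: (x0P (l, true))|apply: (x0P (l, false))].
  have j01 : j ord0 != j (lift ord0 ord0) by apply/eqP => /jI.
  case: (ltngtP (j ord0) (j (lift ord0 ord0))) j01 => // lt _.
    apply: (key _ _ lt); exists x' => c.
    by split; [apply: (x'P ord0 c)|apply: (x'P (lift ord0 ord0) c)].
  apply: (key _ _ lt); exists x' => c.
  by split; [apply: (x'P (lift ord0 ord0) c)|apply: (x'P ord0 c)].
apply.
(* The copy [S' l] belongs to block [l %/ r] and has to be taken at the column chosen there by [f];
   indiscernibility moves column 0 to it. *)
have /choice[F FP] : forall p, exists m, forall l, l < q.+1 -> S' l = p -> m = f (l %/ r).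
  move=> p; have [[l lq <-]|nl] := pselect (exists2 l, l < q.+1 & S' l = p).
    by exists (f (l %/ r)) => l' l'q /S'I ->.
  by exists 0 => l lq lp; case: nl; exists l.
have fg p : same_type (N `|` D p) (s p \o u \o pair 0) (s p \o u \o pair (F p)).
  move=> P PD P0; have [_ _ _ sI] := sP p.
  have addI : incr (addn (F p)) by move=> a b; rewrite ltn_add2l.
  have := iffRL (sI (fun y => P (row y 0)) (definable_row 0 PD) _ addI) P0.
  by rewrite /row /subseq_of /= addn0.
have [|y yP] := path _ (fun p => pair 0) (fun p => pair (F p)) fg _
  (definable_common (fun l : 'I_q.+1 => S l) RD); first by exists x.
exists y => t' t'T c; have lt := tr_lt t' c t'T (ltn_ord c).
have := yP (inord (t' * r + c)).
rewrite -/(S' _) /row /= (FP _ (t' * r + c)) //; last exact: ltnW.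
by rewrite divnMDl ?divn_small ?addn0 // (leq_ltn_trans _ (ltn_ord c)).
Qed.

End Chain.

(** * Extension bases *)

Section ExtensionBase.
Context (L : language) (M : structure L) (K : Type).
Hypothesis sat_M : saturated M K.
Hypothesis hom_M : strongly_homogeneous M K.
Hypothesis small_countable :
  forall A B : set M, small K A -> countable B -> small K (A `|` B).
Hypothesis ntp2 : NTP2 M.
Implicit Types (A B C D E N : set M).

Lemma psatE n (x : 'I_n -> M) (theta : pformula M n) :
  psat x theta <-> sat (sumf x id) theta.
Proof. by split; apply: sat_eqfun => -[]. Qed.

Lemma over_definable A n (theta : pformula M n) : Defs.over A theta ->
  definable A (fun x => psat x theta).
Proof.
by move=> th; exists theta; split; [apply: vars_inW th => -[]|move=> x; apply: psatE].
Qed.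

Lemma definable_over A n (P : ('I_n -> M) -> Prop) : definable A P ->
  exists2 theta : pformula M n, Defs.over A theta & forall x, psat x theta <-> P x.
Proof.
move=> [t [tA tP]]; exists t; first by apply: vars_inW tA => -[].
by move=> x; rewrite psatE tP.
Qed.

Lemma tp_aut A n (a : 'I_n -> M) s : aut A s -> tp A (s \o a) = tp A a.
Proof.
move=> sA; apply/seteqP; split=> theta [oth];
  by move=> h; split=> //; move: h; rewrite (aut_definable _ sA (over_definable oth)).
Qed.

Lemma tp_same_type A n (a b : 'I_n -> M) : tp A b = tp A a -> same_type A a b.
Proof.
move=> e P /definable_over[theta oth thP] /thP Pa; apply/thP.
by have [] : tp A b theta by rewrite e; split.
Qed.

(** The parameters in [A] are made part of the tuple [a]; its images under the inverse automorphisms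
    witness dividing. *)
Lemma dividing_divides A p (U : Type) (Q : ('I_p + U -> M) -> Prop) (u : U -> M) :
  definable A Q -> dividing A (fun x => Q (sumf x u)) ->
  exists psi : pformula M p, divides A psi /\ forall x, psat x psi <-> Q (sumf x u).
Proof.
move=> [t [_ tQ]] [k [s [sA sQ]]].
have [q r g supp] := formula_supportP t; have [m0] := Defs.nonempty M.
pose rho (x : ('I_p + U) + M) : 'I_p + 'I_q.+1 :=
  match x with inl (inl i) => inl i | _ => inr (r x) end.
pose phi := rename rho t.
pose a (i : 'I_q.+1) := if g i is Some x then sumf (sumf (fun=> m0) u) id x else m0.
have phiP x : sat (sumf x a) phi <-> Q (sumf x u).
  rewrite sat_rename tQ; apply: sat_ext supp => -[[i|w]|c] //= e; by rewrite /a e.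
exists (inst phi a); split; last by move=> x; rewrite psat_inst.
have /choice[t' t'P] := fun i => aut_inv (sA i).
exists q.+1, phi, a; split=> //; exists k, (fun i => t' i \o a); split=> [i|j jI [x xP]].
  by apply: tp_aut; case: (t'P i).
apply: (sQ j jI); exists x => i; apply/phiP.
have [tA sK tK] := t'P (j i).
by have /psat_inst := xP i; rewrite (aut_sumfl _ _ (sA (j i)) tA sK tK (definable_sat _ _)).
Qed.

Lemma divides_dividing A n (psi : pformula M n) : small K A -> divides A psi ->
  dividing A (fun x => psat x psi).
Proof.
move=> smallA [m [phi [a [-> [k [b [ba bk]]]]]]].
have /choice[s sP] : forall i, exists s, aut A s /\ s \o b i = a.
  move=> i; have [|s sA sb] := homogeneity hom_M small_countable (a := b i) (b := a) smallA.
    by apply: tp_same_type; rewrite ba.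
  by exists s.
exists k, s; split=> [i|j jI [x xP]]; first by case: (sP i).
apply: (bk j jI); exists x => i; apply/psat_inst.
have [sA sb] := sP (j i); move: (xP i); rewrite psat_inst -sb.
by rewrite (aut_sumf _ _ sA (definable_sat _ _)).
Qed.

Lemma tp_complete A n (a : 'I_n -> M) : complete_types A (tp A a).
Proof.
split=> [theta []//|F _ Fp|theta oth]; first by exists a => theta /Fp [].
by have [?|?] := pselect (psat a theta); [left|right].
Qed.

(** Otherwise, by compactness, the type of [e] over [C] implies the disjunction of the [Q i (x, u)]
    and so forks over [C]. *)
Lemma extension_base_avoid C p (e : 'I_p -> M) (U : countType) (u : U -> M) n
    (Q : nat -> ('I_p + U -> M) -> Prop) :
  small K C -> extension_base C ->
  (forall i, i < n -> definable C (Q i) /\ dividing C (fun x => Q i (sumf x u))) ->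
  exists2 s, aut C s & forall i, i < n -> ~ Q i (sumf (s \o e) u).
Proof.
move=> smallC extC QP.
have smallCu : small K (C `|` range u).
  by apply: small_countable => //; apply: countable_range_fun.
have QD i : i < n -> definable (C `|` range u) (fun x => Q i (sumf x u)).
  move=> lt; apply: (definable_coord (F := fun x => sumf x u) _ (definable_sub _ (QP i lt).1)).
    by move=> [l|w]; [left; exists l|right; exists (u w) => //; right; exists w].
  by move=> x; left.
pose F (P : ('I_p -> M) -> Prop) :=
  (exists2 theta, tp C e theta & P = fun x => psat x theta) \/
  (exists2 i, i < n & P = fun x => ~ Q i (sumf x u)).
have [fs|nfs] := pselect (finitely_sat F).
  have [P|z zF] := realize sat_M small_countable smallCu _ fs.
    case=> [[theta [oth _] ->]|[i lt ->]]; last exact/definable_not/QD.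
    by apply: definable_sub (over_definable oth) => x; left.
  have [|s sC sz] := homogeneity hom_M small_countable (a := e) (b := z) smallC.
    move=> P /definable_over[theta oth thP] /thP Pe; apply/thP.
    by apply: (zF (fun x => psat x theta)); left; exists theta.
  exists s => // i lt; rewrite sz; apply: (zF (fun x => ~ Q i (sumf x u))).
  by right; exists i.
move/existsNP: nfs => [ps /not_implyP[psF /forallNP nsat]].
case: (extC p (tp C e) (tp_complete _ _)).
have [theta _ thP] := definable_over (definable_exists_lt QD).
exists theta.
  have [ts tsp tsP] : exists2 ts, (forall th, List.In th ts -> tp C e th) &
      forall x, (forall th, List.In th ts -> psat x th) ->
        (forall i, i < n -> ~ Q i (sumf x u)) -> satisfies ps x.
    elim: ps psF {nsat} => [|P ps IH] psF; first by exists nil => // x _ _ P [].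
    have [|ts tsp tsP] := IH; first by move=> P' P'ps; apply: psF; right.
    have [[th thp PE]|[i lt PE]] := psF P (or_introl erefl).
      exists (th :: ts) => [th' /= [<-//|/tsp//]|x xt nQ P' /= [<-|]].
        by rewrite PE; apply: xt; left.
      by apply: tsP => // th' th'ts; apply: xt; right.
    exists ts => // x xt nQ P' /= [<-|]; first by rewrite PE; apply: nQ.
    exact: tsP.
  exists [set th | List.In th ts]; split=> //; first exact: finite_In.
  move=> x xt; apply/thP; apply: contrapT => nQ; apply: (nsat x); apply: tsP => // i lt Qi.
  by apply: nQ; exists i.
have /choice[psi psiP] : forall i, exists psi : pformula M p, i < n ->
    divides C psi /\ forall x, psat x psi <-> Q i (sumf x u).
  move=> i; have [lt|_] := boolP (i < n); last by exists theta.
  by have [psi ?] := dividing_divides (QP i lt).1 (QP i lt).2; exists psi.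
exists [set th | List.In th (mkseq psi n)]; split; first exact: finite_In.
  move=> th /(In_nth theta)[i]; rewrite size_mkseq => lt <-; rewrite nth_mkseq //.
  by case: (psiP i lt).
move=> x /thP[i lt Qi]; exists (psi i); last by apply/(psiP i lt).2.
have := @nth_In _ theta (mkseq psi n) i; rewrite size_mkseq nth_mkseq //; exact.
Qed.

(** By compactness finitely many elements [e] of [N] matter. An automorphism takes [e] off the
    dividing formulas; its inverse, applied to [u], has the same effect with [N] left in place. *)
Lemma extension_base_nondividing C N (U : countType) (u : U -> M) :
  small K N -> C `<=` N -> extension_base C ->
  exists2 s, aut C s & nondividing C N (s \o u).
Proof.
move=> smallN CN extC; have smallC := small_sub CN smallN.
pose F (P : (U -> M) -> Prop) := (definable C P /\ P u) \/
  (exists k (e : 'I_k -> M) Q, [/\ forall i, N (e i), definable C Q,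
     dividing C (fun x => Q (sumf x u)) & P = fun v => ~ Q (sumf e v)]).
have [P|ps psF|v vF] := realize sat_M small_countable (F := F) smallN.
- case=> [[PD _]|[k [e [Q [eN QD _ ->]]]]]; first exact: definable_sub PD.
  apply: definable_not; apply: (definable_coord (F := fun v => sumf e v) _ (definable_sub CN QD)).
  by move=> [i|w]; [right; exists (e i)|left; exists w].
- have [g [p [e [n [Q [gD gu QP gQ]]]]]] : exists g p (e : 'I_p -> M) n
      (Q : nat -> ('I_p + U -> M) -> Prop), [/\ definable C g, g u,
      forall i, i < n -> definable C (Q i) /\ dividing C (fun x => Q i (sumf x u)) &
      forall v, g v -> (forall i, i < n -> ~ Q i (sumf e v)) -> satisfies ps v].
    elim: ps psF => [|P ps IH] psF.
      have [m0] := Defs.nonempty M.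
      exists (fun=> True), 0, (fun=> m0), 0, (fun _ _ => True); split=> //.
        exact: definable_true.
      by move=> v _ _ P [].
    have [|g [p [e [n [Q [gD gu QP gQ]]]]]] := IH; first by move=> P' P'ps; apply: psF; right.
    have [[PD Pu]|[k [e' [Q' [_ Q'D Q's PE]]]]] := psF P (or_introl erefl).
      exists (fun v => g v /\ P v), p, e, n, Q; split=> //; first exact: definable_and.
      by move=> v [gv Pv] nQ P' /= [<-//|]; apply: gQ.
    exists g, (p + k), (fun i => sumf e e' (fintype.split i)), n.+1, (fun i y =>
      if i is i'.+1 then Q i' (sumf (y \o inl \o @lshift p k) (y \o inr))
      else Q' (sumf (y \o inl \o @rshift p k) (y \o inr))); split=> //.
      case=> [_|i /QP[QD Qs]]; split.
      + apply: (definable_coord (F := fun y => sumf (y \o inl \o @rshift p k) (y \o inr)) _ Q'D).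
        by move=> [i|w]; left; [exists (inl (rshift p i))|exists (inr w)].
      + exact: (dividing_reindex (@rshift p k) Q's).
      + apply: (definable_coord (F := fun y => sumf (y \o inl \o @lshift p k) (y \o inr)) _ QD).
        by move=> [j|w]; left; [exists (inl (lshift k j))|exists (inr w)].
      + exact: (dividing_reindex (@lshift p k) Qs).
    have ee' : sumf e e' \o @fintype.split p k \o @rshift p k = e'.
      by apply: funext => i /=; rewrite (unsplitK (inr i)).
    have ee : sumf e e' \o @fintype.split p k \o @lshift p k = e.
      by apply: funext => i /=; rewrite (unsplitK (inl i)).
    move=> v gv nQ P' /= [<-|].
      by rewrite PE -ee'; apply: (nQ 0).
    by apply: gQ => // i lt; rewrite -ee; apply: (nQ i.+1).
  have [s sC nQ] := extension_base_avoid e smallC extC QP.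
  have [t [tC sK tK]] := aut_inv sC.
  exists (t \o u); apply: gQ; first by apply/(aut_definable _ tC gD).
  move=> i lt; have [QD _] := QP i lt.
  by rewrite -(aut_sumfl _ _ sC tC sK tK QD); apply: nQ.
have [|s sC su] := homogeneity hom_M small_countable (a := u) (b := v) smallC.
  by move=> P PD Pu; apply: vF; left.
exists s => // k e Q eN QD; rewrite su => Qv dv.
apply: (vF (fun v => ~ Q (sumf e v))) Qv; right; exists k, e, Q; split=> //.
have [t [tC sK tK]] := aut_inv sC.
have := dividing_conj tC QD dv.
by have -> : t \o v = u by rewrite -su; apply: funext => w /=; rewrite sK.
Qed.

(* Since the type of [N] over [C] and [b] does not divide over [C], a [C]-indiscernible sequence
   starting at [b] can be moved so that all its terms have the type of [b] over [N]. *)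
Lemma dividing_lift C N Z (W : countType) (R : (Z + W -> M) -> Prop) b :
  small K N -> C `<=` N -> definable C R -> nondividing C N b ->
  dividing C (fun x => R (sumf x b)) -> dividing N (fun x => R (sumf x b)).
Proof.
move=> smallN CN RD ndb dv; have smallC := small_sub CN smallN.
have [k [u [uI u0 uR]]] := dividing_indiscernible sat_M hom_M small_countable smallC RD dv.
have CNN : C `|` N = N by apply/setUidPr.
have smallCN : small K (C `|` N) by rewrite CNN.
have [t tC /=] := indiscernible_shift sat_M hom_M small_countable smallCN uI u0 ndb.
rewrite CNN => tP.
have /choice[s sP] : forall l, exists s, aut N s /\ t \o row u l = s \o b.
  by move=> l; have [s sN sl] := tP l; exists s.
have /choice[s' s'P] : forall l, exists s', [/\ aut N s', cancel (s l) s' & cancel s' (s l)].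
  by move=> l; apply: aut_inv; case: (sP l).
exists k, s'; split=> [i|j jI [x xP]]; first by case: (s'P i).
have [t' [t'C tK t'K]] := aut_inv tC.
apply: (uR j jI); exists (t' \o x) => i.
rewrite (aut_sumfl _ _ t'C tC) //.
have [sN sE] := sP (j i); have [s'N sK s'K] := s'P (j i); rewrite sE.
by have := xP i; rewrite (aut_sumfl _ _ (aut_sub CN s'N) (aut_sub CN sN)).
Qed.

Lemma dividing_unconj A Z (W : Type) (R : (Z + W -> M) -> Prop) b s : aut A s -> definable A R ->
  dividing A (fun x => R (sumf x (s \o b))) -> dividing A (fun x => R (sumf x b)).
Proof.
move=> sA RD dv; have [t [tA sK tK]] := aut_inv sA.
have := dividing_conj tA RD dv.
by have -> : t \o (s \o b) = b by apply: funext => w /=; rewrite sK.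
Qed.

(** The parameters are conjugated so that dividing over [C] passes up to [N], where Kim's lemma
    applies; passing down to [C] is automatic. *)
Lemma dividing_union C N Z (W : countType) (b : W -> M) n
    (R : nat -> (Z + W -> M) -> Prop) :
  small K N -> elementary N -> C `<=` N -> extension_base C ->
  (forall i, i < n -> definable C (R i) /\ dividing C (fun x => R i (sumf x b))) ->
  dividing C (fun x => exists2 i, i < n & R i (sumf x b)).
Proof.
move=> smallN elemN CN extC RP.
have [s sC ndb] := extension_base_nondividing b smallN CN extC.
apply: (@dividing_unconj _ _ _ (fun y => exists2 i, i < n & R i y) _ _ sC).
  by apply: definable_exists_lt => i /RP[].
apply: (dividing_base CN).
apply: (dividing_union_elementary sat_M hom_M small_countable ntp2 smallN elemN).
move=> i /RP[RD Rs]; split; first exact: definable_sub CN RD.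
exact: (dividing_lift smallN CN RD ndb (dividing_conj sC RD Rs)).
Qed.

Lemma dividing_chain C N Z (W : countType) (R : (Z + W -> M) -> Prop) u :
  small K N -> elementary N -> C `<=` N -> extension_base C ->
  definable C R -> indisc C u ->
  dividing C (fun x => R (sumf x (row u 0)) /\ R (sumf x (row u 1))) ->
  dividing C (fun x => R (sumf x (row u 0))).
Proof.
move=> smallN elemN CN extC RD uI dv.
have [s sC nds] := extension_base_nondividing u smallN CN extC.
have CNN : C `|` N = N by apply/setUidPr.
have smallCN : small K (C `|` N) by rewrite CNN.
(* [chain_elementary] needs a sequence indiscernible over [N], and the given one is so only over
   [C]. *)
have [t [tC]] := indiscernible_nondividing sat_M hom_M small_countable smallCN
  (indisc_aut sC uI) nds.
rewrite CNN => tI ndt _.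
have R2D : definable C (fun y : Z + nat * W -> M =>
    R (sumf (y \o inl) (row (y \o inr) 0)) /\ R (sumf (y \o inl) (row (y \o inr) 1))).
  by apply: definable_and;
    apply: (definable_coord (F := fun y => sumf (y \o inl) (row (y \o inr) _)) _ RD);
    move=> [z|w]; left; eexists.
apply: (@dividing_unconj _ _ _ R _ (t \o s)) => //; first exact: aut_comp.
apply: (dividing_base CN).
apply: (chain_elementary sat_M hom_M small_countable ntp2 smallN elemN (definable_sub CN RD) tI).
apply: (dividing_lift smallN CN R2D ndt).
exact: (dividing_conj tC R2D (dividing_conj sC R2D dv)).
Qed.

End ExtensionBase.

(** * Cardinality and small elementary submodels *)

Definition injects (T U : Type) := exists f : T -> U, injective f.

Lemma card_le_injects T U (A : set U) : [set: T] #<= A <->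
  exists f : T -> U, injective f /\ forall x, A (f x).
Proof.
split=> [/card_leP[f]|[f [fI fA]]].
  pose s (x : T) : [set: T] := SigSub (mem_set (I : [set: T] x)).
  exists (fun x => set_val (f (s x))); split=> [x y /val_inj|x]; last exact: set_valP.
  by move=> /(@inj _ _ _ f); rewrite !inE => /(_ I I) /(congr1 val).
have fT : {in [set: T] &, injective f} by move=> x y _ _; apply: fI.
apply: card_le_trans (_ : [set: T] #<= f @` [set: T]) _.
  by have := inj_card_eq fT; rewrite card_eq_sym => /card_eqPle[].
by apply: subset_card_le => _ [x _ <-].
Qed.

Lemma injects_trans T U V : injects T U -> injects U V -> injects T V.
Proof. by move=> [f fI] [g gI]; exists (g \o f); apply: inj_comp. Qed.

(** Zorn on graphs of partial injections: a maximal one is total or onto, or else a pair of missed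
    points could be added. *)
Lemma injects_total T U : injects T U \/ injects U T.
Proof.
pose P (G : set (T * U)) := forall a b, G a -> G b -> a.1 = b.1 <-> a.2 = b.2.
have [G [GP Gmax]] : exists A, P A /\ forall B, A `<` B -> ~ P B.
  apply: Zorn_bigcup => F FP Ftot a b [X FX Xa] [Y FY Yb].
  have [XY|YX] := Ftot X Y FX FY; last by apply: (FP X FX) => //; apply: YX.
  by apply: (FP Y FY) => //; apply: XY.
have [dT|/existsNP[x nx]] := pselect (forall x, exists y, G (x, y)).
  have [f fP] := choice dT; left; exists f => x y e.
  exact: (iffRL (GP _ _ (fP x) (fP y))).
have [rT|/existsNP[y ny]] := pselect (forall y, exists x, G (x, y)).
  have [f fP] := choice rT; right; exists f => z y e.
  exact: (iffLR (GP _ _ (fP z) (fP y))).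
case: (Gmax (G `|` [set (x, y)])).
  split; last by move=> /(_ (x, y) (or_intror erefl)) Gxy; apply: nx; exists y.
  by move=> z Gz; left.
have old z : G z -> x = z.1 <-> y = z.2.
  by case: z => a b Gz; split=> /= e; [case: nx; exists b|case: ny; exists a]; rewrite e.
move=> a b [Ga|->] [Gb|->] //=; first exact: GP.
  by have [h1 h2] := old a Ga; split=> /esym e; apply/esym; [apply: h1|apply: h2].
exact: old.
Qed.

(* Zorn on the graphs of injections [S x S -> S]. If the complement of a maximal [S] is at least
   as large as [S], the injection extends to [S] together with a disjoint copy of [S]; otherwise
   [T] injects into [S x S], hence into [S]. *)
Lemma injects_square T : injects nat T -> injects (T * T) T.
Proof.
move=> [z zI].
pose Q (G : set ((T * T) * T)) := let S x := exists c, G ((x, x), c) in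
  [/\ forall a b c, G ((a, b), c) -> [/\ S a, S b & S c],
      forall a b, S a -> S b -> exists c, G ((a, b), c) &
      forall u v, G u -> G v -> u.1 = v.1 <-> u.2 = v.2].
pose G0 : set ((T * T) * T) :=
  [set u | exists i j, u = ((z i, z j), z (pickle (i, j)))].
have QG0 : Q G0.
  split.
  - move=> a b c [i [j [-> -> ->]]]; split; eexists; eexists; by eexists.
  - by move=> a b [c [i [_ [-> _ _]]]] [d [j [_ [-> _ _]]]]; eexists; exists i, j.
  - move=> u v [i [j ->]] [i' [j' ->]] /=; split=> [[/zI -> /zI ->]//|].
    by move=> /zI /(pcan_inj pickleK) [-> ->].
(* The union with [G0] makes the property true of the empty chain and keeps [S] infinite. *)
have [X [QX Xmax]] : exists X, Q (X `|` G0) /\ forall Y, X `<` Y -> ~ Q (Y `|` G0).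
  apply: (@Zorn_bigcup _ (fun X => Q (X `|` G0))) => F FQ Ftot.
  have FF u v : (\bigcup_(X in F) X `|` G0) u -> (\bigcup_(X in F) X `|` G0) v ->
      exists X, [/\ Q (X `|` G0), X `<=` \bigcup_(X in F) X, (X `|` G0) u & (X `|` G0) v].
    move=> [[X FX Xu]|Gu] [[Y FY Yv]|Gv].
    - have [XY|YX] := Ftot X Y FX FY.
        exists Y; split; [exact: FQ|exact: bigcup_sup|by left; apply: XY|by left].
      exists X; split; [exact: FQ|exact: bigcup_sup|by left|by left; apply: YX].
    - exists X; split; [exact: FQ|exact: bigcup_sup|by left|by right].
    - exists Y; split; [exact: FQ|exact: bigcup_sup|by right|by left].
    - by exists set0; split; [rewrite set0U| |right|right].
  have up X u : X `<=` \bigcup_(X in F) X -> (X `|` G0) u -> (\bigcup_(X in F) X `|` G0) u.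
    by move=> XF [/XF|]; [left|right].
  split.
  - move=> a b c Gu; have [X [[h _ _] XF Xu _]] := FF _ _ Gu Gu.
    by have [[a' ?] [b' ?] [c' ?]] := h a b c Xu; split; eexists; apply: up XF _; eassumption.
  - move=> a b [c Gc] [d Gd]; have [X [[_ h _] XF Xu Xv]] := FF _ _ Gc Gd.
    have [||e Xe] := h a b; [by exists c|by exists d|].
    by exists e; apply: up XF _.
  - move=> u v Gu Gv; have [X [[_ _ h] XF Xu Xv]] := FF _ _ Gu Gv.
    exact: h.
pose G := X `|` G0; pose S x := exists c, G ((x, x), c).
have [G1 G2 G3] : [/\ forall a b c, G ((a, b), c) -> [/\ S a, S b & S c],
      forall a b, S a -> S b -> exists c, G ((a, b), c) &
      forall u v, G u -> G v -> u.1 = v.1 <-> u.2 = v.2] by [].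
have zS i : S (z i) by eexists; right; exists i, i.
have /choice[g0 g0P] : forall u : T * T, exists c, S u.1 -> S u.2 -> G (u, c).
  move=> [a b]; have [[Sa Sb]|nS] := pselect (S a /\ S b).
    by have [c Gc] := G2 a b Sa Sb; exists c.
  by exists a => Sa Sb; case: nS.
pose g a b := g0 (a, b).
have gS a b : S a -> S b -> S (g a b).
  by move=> Sa Sb; have [] := G1 _ _ _ (g0P (a, b) Sa Sb).
have gI a b a' b' : S a -> S b -> S a' -> S b' -> g a b = g a' b' -> a = a' /\ b = b'.
  move=> Sa Sb Sa' Sb' e.
  by have [_ /(_ e) /= [-> ->]] := G3 _ _ (g0P (a, b) Sa Sb) (g0P (a', b') Sa' Sb').
have z01 : z 0 <> z 1 by move=> /zI.
(* If [inv] sends further points injectively into [S], then [S] and these points together embed into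
   [S], the tags [z 0] and [z 1] keeping them apart. *)
pose codef (inv : T -> T) x := if `[< S x >] then g x (z 0) else g (inv x) (z 1).
have codeS inv x : (~ S x -> S (inv x)) -> S (codef inv x).
  by rewrite /codef; case: asboolP => [Sx _|nS /(_ nS) Si]; apply: gS.
have codeI inv x y : (~ S x -> S (inv x)) -> (~ S y -> S (inv y)) ->
    (~ S x -> ~ S y -> inv x = inv y -> x = y) -> codef inv x = codef inv y -> x = y.
  rewrite /codef => ix iy ixy; case: asboolP => Sx; case: asboolP => Sy.
  - by move=> e; have [] := gI _ _ _ _ Sx (zS 0) Sy (zS 0) e.
  - by move=> e; have [_ /z01] := gI _ _ _ _ Sx (zS 0) (iy Sy) (zS 1) e.
  - by move=> e; have [_ /esym/z01] := gI _ _ _ _ (ix Sx) (zS 1) Sy (zS 0) e.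
  - by move=> e; have [/(ixy Sx Sy)] := gI _ _ _ _ (ix Sx) (zS 1) (iy Sy) (zS 1) e.
have [[h hI]|[h hI]] := injects_total {x | ~ S x} {x | S x}.
  pose inv x := match pselect (S x) with left _ => x | right nS => sval (h (exist _ x nS)) end.
  have invS x : ~ S x -> S (inv x).
    by rewrite /inv; case: pselect => // nS _; case: (h _).
  have cI x y : codef inv x = codef inv y -> x = y.
    apply: codeI => //; [exact: invS|exact: invS|move=> nx ny].
    rewrite /inv; case: pselect => // nx'; case: pselect => // ny' e.
    suff /hI [] : h (exist _ x nx') = h (exist _ y ny') by [].
    by move: e; case: (h _) => x1 p1; case: (h _) => y1 q1 /= e; apply: eq_exist.
  have cS x : S (codef inv x) by apply/codeS/invS.
  exists (fun u => g (codef inv u.1) (codef inv u.2)) => -[a b] [a' b'] /= e.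
  by have [/cI -> /cI ->] := gI _ _ _ _ (cS a) (cS b) (cS a') (cS b') e.
pose hh x := match pselect (S x) with left p => sval (h (exist _ x p)) | right _ => x end.
have hhS x : S x -> ~ S (hh x).
  by rewrite /hh; case: pselect => // p _; case: (h _).
have hhI x y : S x -> S y -> hh x = hh y -> x = y.
  rewrite /hh; case: pselect => // p _; case: pselect => // q _ e.
  suff /hI [] : h (exist _ x p) = h (exist _ y q) by [].
  by move: e; case: (h _) => x1 p1; case: (h _) => y1 q1 /= e; apply: eq_exist.
have /choice[inv invP] : forall x, exists y, forall s, S s -> x = hh s -> y = s.
  move=> x; have [[s Ss ->]|ns] := pselect (exists2 s, S s & x = hh s).
    by exists s => s' Ss' /(hhI _ _ Ss Ss').
  by exists x => s Ss xs; case: ns; exists s.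
pose S2 x := S x \/ exists2 s, S s & x = hh s.
have S2inv x : S2 x -> ~ S x -> S (inv x).
  by move=> [//|[s Ss xs]] _; rewrite (invP x s Ss xs).
have c2I x y : S2 x -> S2 y -> codef inv x = codef inv y -> x = y.
  move=> Sx Sy; apply: codeI; [exact: S2inv|exact: S2inv|move=> nx ny].
  case: Sx => // -[s Ss xs]; case: Sy => // -[s' Ss' ys].
  by rewrite (invP _ _ Ss xs) (invP _ _ Ss' ys) xs ys => ->.
have c2S x : S2 x -> S (codef inv x) by move=> /S2inv; apply: codeS.
(* The new pairs take values in the copy [hh] of [S], outside [S], and so cannot collide with the
   old ones. *)
pose G' : set ((T * T) * T) := [set u | [/\ S2 u.1.1, S2 u.1.2, ~ (S u.1.1 /\ S u.1.2) &
  u.2 = hh (g (codef inv u.1.1) (codef inv u.1.2))]].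
case: (Xmax (X `|` G')).
  split; first by move=> u Xu; left.
  pose x := hh (z 0); have S2x : S2 x by right; exists (z 0).
  move=> /(_ ((x, x), hh (g (codef inv x) (codef inv x)))) XG.
  have /XG Xx : (X `|` G') ((x, x), hh (g (codef inv x) (codef inv x))).
    by right; split=> //= -[/(hhS _ (zS 0))].
  by have [/(hhS _ (zS 0))] := G1 x x _ (or_introl Xx).
have -> : X `|` G' `|` G0 = G `|` G' by rewrite setUAC.
have S2P x : S2 x -> exists c, (G `|` G') ((x, x), c).
  move=> S2x; have [[c Gc]|nS] := pselect (S x); first by exists c; left.
  by eexists; right; split=> //= -[].
split.
- move=> a b c [/G1[Sa Sb Sc]|[/= Sa Sb _ ->]].
    by split; apply: S2P; left.
  by split; apply: S2P => //; right; eexists; last reflexivity; apply: gS; apply: c2S.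
- have PS2 x : (exists c, (G `|` G') ((x, x), c)) -> S2 x.
    by move=> [c [/G1[]|[]//]]; left.
  move=> a b /PS2 Sa /PS2 Sb; have [[Sa' Sb']|nS] := pselect (S a /\ S b).
    by have [c Gc] := G2 a b Sa' Sb'; exists c; left.
  by exists (hh (g (codef inv a) (codef inv b))); right; split.
- have dis u v : G u -> G' v -> u.1 = v.1 <-> u.2 = v.2.
    case: u v => [[a b] c] [[a' b'] c'] /= /G1[Sa Sb Sc] [/= Sa' Sb' nS cE].
    split=> [[ea eb]|e]; first by case: nS; rewrite -ea -eb.
    case: (hhS (g (codef inv a') (codef inv b'))); first by apply: gS; apply: c2S.
    by rewrite -cE -e.
  move=> u v [Gu|Gu] [Gv|Gv]; first exact: G3.
  - exact: dis.
  - by have [h1 h2] := dis v u Gv Gu; split=> e; apply/esym; [apply: h1|apply: h2].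
  - case: u v Gu Gv => [[a b] c] [[a' b'] c'] [/= Sa Sb _ ->] [/= Sa' Sb' _ ->].
    split=> [[-> ->] //|/= e].
    have := hhI _ _ (gS _ _ (c2S _ Sa) (c2S _ Sb)) (gS _ _ (c2S _ Sa') (c2S _ Sb')) e.
    move=> /(gI _ _ _ _ (c2S _ Sa) (c2S _ Sb) (c2S _ Sa') (c2S _ Sb')) [].
    by move=> /(c2I _ _ Sa Sa') -> /(c2I _ _ Sb Sb') ->.
Qed.

(** [T] embeds into two copies of [Y], hence into [Y] if [Y] is infinite; otherwise [T] would be
    countable. *)
Lemma injects_absorb T X Y : ~ injects T nat -> injects T (X + Y) -> injects X Y ->
  injects T Y.
Proof.
move=> nT [f fI] [h hI].
have TY : injects T (bool * Y).
  exists (fun k => match f k with inl x => (true, h x) | inr y => (false, y) end).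
  move=> k k' e; apply: fI; move: e.
  by case: (f k) => x; case: (f k') => x' // [] e; [rewrite (hI _ _ e)|rewrite e].
have [natY|Ynat] := injects_total nat Y.
  apply: injects_trans TY _; apply: injects_trans (injects_square natY).
  have [z zI] := natY; exists (fun u => (z (nat_of_bool u.1), u.2)) => -[a b] [a' b'] /= [/zI e ->].
  by case: a a' e => -[].
case: nT; apply: injects_trans TY _; have [g gI] := Ynat.
exists (fun u => pickle (u.1, g u.2)) => -[a b] [a' b'] /(pcan_inj pickleK) [/= -> /gI ->].
by [].
Qed.

Lemma injects_sum T X Y : ~ injects T nat -> injects T (X + Y) ->
  injects T X \/ injects T Y.
Proof.
move=> nT TXY; have [XY|YX] := injects_total X Y.
  by right; apply: injects_absorb TXY XY.
left; apply: (@injects_absorb T Y X) => //; apply: injects_trans TXY _.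
by exists (fun s => match s with inl x => inr x | inr y => inl y end) => -[x|x] [y|y] // [->].
Qed.

(** * Injective codes for formulas and Skolem terms *)

Section Coding.
Context (S : Type) (z : nat -> S) (p : S -> S -> S).
Hypothesis z_inj : injective z.
Hypothesis p_inj : forall a b a' b', p a b = p a' b' -> a = a' /\ b = b'.

Lemma tag_inj i j a b : p (z i) a = p (z j) b -> i = j /\ a = b.
Proof. by move=> /p_inj [/z_inj -> ->]. Qed.

Fixpoint seq_code (s : seq S) : S :=
  if s is x :: s' then p (z 1) (p x (seq_code s')) else p (z 0) (z 0).

Lemma seq_code_inj : injective seq_code.
Proof.
elim=> [|x s IH] [|y t] //=.
- by move=> /tag_inj[].
- by move=> /tag_inj[].
- by move=> /tag_inj[_ /p_inj [-> /IH ->]].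
Qed.

Definition fun_code n (f : 'I_n -> S) := seq_code [seq f i | i <- enum 'I_n].

Lemma fun_code_inj n (f g : 'I_n -> S) : fun_code f = fun_code g -> f =1 g.
Proof.
by move=> /seq_code_inj /eq_in_map fg i; apply: fg; rewrite mem_enum.
Qed.

Context (L : language) (cf : Defs.fsym L -> S) (cr : Defs.rsym L -> S).
Hypothesis cf_inj : injective cf.
Hypothesis cr_inj : injective cr.

Fixpoint term_code V (e : V -> S) (t : term L V) : S :=
  match t with
  | Var v => p (z 0) (e v)
  | App f ts => p (z 1) (p (cf f) (fun_code (fun i => term_code e (ts i))))
  end.

Lemma term_code_inj V (e : V -> S) : injective e -> injective (term_code e).
Proof.
move=> eI; elim=> [v|f ts IH] [w|g us] /=.
- by move=> /tag_inj[_ /eI ->].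
- by move=> /tag_inj[].
- by move=> /tag_inj[].
- move=> /tag_inj[_ /p_inj[/cf_inj fg]]; subst g => /fun_code_inj h.
  by congr App; apply: funext => i; apply/IH/h.
Qed.

Definition option_code V (e : V -> S) (o : option V) :=
  if o is Some v then p (z 1) (e v) else p (z 0) (z 0).

Lemma option_code_inj V (e : V -> S) : injective e -> injective (option_code e).
Proof.
move=> eI [v|] [w|] //=; last 2 first.
- by move=> /tag_inj[].
- by move=> /tag_inj[].
by move=> /tag_inj[_ /eI ->].
Qed.

Fixpoint formula_code V (e : V -> S) (phi : formula L V) : S :=
  match phi with
  | Eq t u => p (z 0) (p (term_code e t) (term_code e u))
  | Rel r ts => p (z 1) (p (cr r) (fun_code (fun i => term_code e (ts i))))
  | Not f => p (z 2) (formula_code e f)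
  | And f g => p (z 3) (p (formula_code e f) (formula_code e g))
  | Ex f => p (z 4) (formula_code (option_code e) f)
  end.

Lemma formula_code_inj V (e : V -> S) : injective e -> injective (formula_code e).
Proof.
move=> eI phi; elim: phi e eI => {V} [V t u|V r ts|V f IH|V f IHf g IHg|V f IH] e eI
  [t' u'|r' ts'|f'|f' g'|f'] //=; try by move=> /tag_inj[].
- by move=> /tag_inj[_ /p_inj[/(term_code_inj eI) -> /(term_code_inj eI) ->]].
- move=> /tag_inj[_ /p_inj[/cr_inj rr]]; subst r' => /fun_code_inj h.
  by congr Rel; apply: funext => i; apply/(term_code_inj eI)/h.
- by move=> /tag_inj[_ /(IH _ eI) ->].
- by move=> /tag_inj[_ /p_inj[/(IHf _ eI) -> /(IHg _ eI) ->]].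
- by move=> /tag_inj[_ /(IH _ (option_code_inj eI)) ->].
Qed.

End Coding.

(** [SkWitness phi i ts] stands for the [i]-th coordinate of a chosen solution [x] of [phi (x, ts)];
    whole tuples are chosen because [elementary] speaks of tuples. The hull is the set of values of
    these terms, and its size is bounded by coding them. *)
Inductive skolem_term (L : language) (C : Type) : Type :=
| SkBase of C
| SkWitness a b (phi : formula L ('I_a + 'I_b)) (i : 'I_a) of ('I_b -> skolem_term L C).

Section SkolemCode.
Context (S : Type) (z : nat -> S) (p : S -> S -> S) (L : language) (C : Type).
Context (cf : Defs.fsym L -> S) (cr : Defs.rsym L -> S) (cc : C -> S).
Hypothesis z_inj : injective z.
Hypothesis p_inj : forall a b a' b', p a b = p a' b' -> a = a' /\ b = b'.
Hypothesis cf_inj : injective cf.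
Hypothesis cr_inj : injective cr.
Hypothesis cc_inj : injective cc.

Definition sum_code a b (x : 'I_a + 'I_b) : S :=
  match x with inl i => p (z 0) (z i) | inr j => p (z 1) (z j) end.

Lemma sum_code_inj a b : injective (@sum_code a b).
Proof.
move=> [i|i] [j|j] /= /(tag_inj z_inj p_inj) [] // _ /z_inj h; congr (_ _); exact: ord_inj.
Qed.

Fixpoint skolem_code (s : skolem_term L C) : S :=
  match s with
  | SkBase c => p (z 0) (cc c)
  | SkWitness a b phi i ts => p (z 1) (p (p (z a) (z b))
     (p (formula_code z p cf cr (@sum_code a b) phi)
        (p (z i) (fun_code z p (fun j => skolem_code (ts j))))))
  end.

Lemma skolem_code_inj : injective skolem_code.
Proof.
elim=> [c|a b phi i ts IH] [c'|a' b' phi' i' ts'] /=; try by move=> /(tag_inj z_inj p_inj)[].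
  by move=> /(tag_inj z_inj p_inj)[_ /cc_inj ->].
move=> /(tag_inj z_inj p_inj)[_ /p_inj[/p_inj[/z_inj aa /z_inj bb]]]; subst a' b'.
move=> /p_inj[/(formula_code_inj z_inj p_inj cf_inj cr_inj (@sum_code_inj a b)) -> ].
move=> /p_inj[/z_inj/ord_inj -> /(fun_code_inj z_inj p_inj) h].
by congr SkWitness; apply: funext => j; apply/IH/h.
Qed.

End SkolemCode.

Section SmallSets.
Context (L : language) (M : structure L) (K : Type).
Hypothesis K_large : ~ ([set: K] #<= [set: Defs.fsym L + Defs.rsym L + nat]).
Implicit Types (A B C D E N : set M).

Lemma K_uncountable : ~ injects K nat.
Proof.
move=> [f fI]; apply: K_large; apply/card_le_injects; exists (fun k => inr (f k)).
by split=> // k k' [/fI].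
Qed.

Lemma smallP A : small K A <-> ~ injects K {x | A x}.
Proof.
rewrite /small card_le_injects; split=> H [f]; last first.
  move=> [fI fA]; apply: H; exists (fun k => exist _ (f k) (fA k)) => k k' e.
  by apply: fI; case: e.
move=> fI; apply: H; exists (fun k => sval (f k)); split; last by move=> k; case: (f k).
move=> k k' e; apply: fI; case: (f k) (f k') e => x p [y q] /= e; exact: eq_exist.
Qed.

(** This provides the hypothesis [small_countable] of the earlier sections: an uncountable [K]
    injecting into a sum injects into a summand. *)
Lemma small_setU_countable A B : small K A -> countable B -> small K (A `|` B).
Proof.
move=> /smallP sA cB; apply/smallP => KAB.
have [|//|KB] := @injects_sum K {x | A x} {x | B x} K_uncountable.
  apply: injects_trans KAB _.
  exists (fun u => match pselect (A (sval u)) with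
    | left h => inl (exist _ (sval u) h)
    | right h => inr (exist _ (sval u) (or_ind (fun a => False_ind _ (h a)) id (svalP u))) end).
  move=> [x xP] [y yP] /=; case: pselect => ? /=; case: pselect => ? //= -[e];
  exact: eq_exist.
apply: K_uncountable; apply: injects_trans KB _.
have /countable_injP[f fI] := cB; exists (fun u => f (sval u)) => -[x Bx] [y By] /= e.
by apply: eq_exist; apply: fI e; rewrite inE.
Qed.

(** Downward Loewenheim-Skolem: parameters in the Skolem hull of [C] are values of terms, so a
    solution is given by further terms. *)
Lemma small_elementary C : small K C -> exists N, [/\ small K N, elementary N & C `<=` N].
Proof.
move=> sC; have [m0] := Defs.nonempty M.
pose wit a b (phi : formula L ('I_a + 'I_b)) (e : 'I_b -> M) : 'I_a -> M :=
  match pselect (exists w, sat (sumf w e) phi) with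
  | left h => sval (cid h) | right _ => fun=> m0 end.
have witP a b (phi : formula L ('I_a + 'I_b)) e w :
    sat (sumf w e) phi -> sat (sumf (wit a b phi e) e) phi.
  by rewrite /wit => h; case: pselect => [h'|[]]; [case: cid|exists w].
pose ev := fix ev (s : skolem_term L {x | C x}) : M := match s with
  | SkBase c => sval c
  | SkWitness a b phi i ts => wit a b phi (fun j => ev (ts j)) i end.
exists (range ev); split; last 2 first.
- move=> V P u [t [tN tP]] _ Pu.
  have [q r g supp] := formula_supportP t.
  (* A default for indices without a parameter: a witness of [x = x], available even if [C] is
     empty. *)
  pose sk0 : skolem_term L {x | C x} := SkWitness (a := 1) (b := 0)
    (Eq (Var L (inl ord0)) (Var L (inl ord0))) ord0
    (fun j : 'I_0 => match notF (ltn_ord j) with end).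
  pose rho (x : V + M) : 'I_q.+1 + 'I_q.+1 :=
    match x with inl v => inl (r x) | inr c => inr (r x) end.
  have /choice[ts tsP] : forall i, exists s, forall c, g i = Some (inr c) -> range ev c -> ev s = c.
    move=> i; case: (g i) => [[v|c]|]; try by exists sk0.
    have [[s _ sc]|nc] := pselect (range ev c); first by exists s => d [<-].
    by exists sk0 => d [<-].
  have cP x : (sumf (fun=> True) (range ev `|` set0) x /\ g (r x) = Some x) ->
      forall c, x = inr c -> ev (ts (r x)) = c.
    by move=> [xN gx] c xc; apply: tsP; [rewrite gx xc|move: xN; rewrite xc => -[]].
  have supp' := vars_in_and tN supp.
  pose u' i := if g i is Some (inl v) then u v else m0.
  have Pu' : sat (sumf u' (fun i => ev (ts i))) (rename rho t).
    rewrite sat_rename; move/tP: Pu; apply: (iffLR (sat_ext _ supp')) => -[v|c] h /=.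
      by rewrite /u' h.2.
    by rewrite (cP _ h c erefl).
  exists (fun v => ev (SkWitness (rename rho t) (r (inl v)) ts)); first by move=> v; eexists.
  move/witP: Pu'; rewrite sat_rename tP.
  apply: (iffLR (sat_ext _ supp')) => -[v|c] h //=.
  exact: (cP _ h c erefl).
- by move=> x Cx; exists (SkBase L (exist _ x Cx)).
apply/smallP => KN.
(* [S] is infinite, so [S * S] and with it all Skolem terms inject into [S]; [K] would then inject
   into [C] or into the symbols and [nat]. *)
pose S := ({x | C x} + (Defs.fsym L + Defs.rsym L + nat))%type.
have [p pI] : injects (S * S) S.
  by apply: injects_square; exists (fun n => inr (inr n)) => n n' [].
pose cd := @skolem_code S (fun n => inr (inr n)) (fun a b => p (a, b)) L {x | C x}
  (fun f => inr (inl (inl f))) (fun f => inr (inl (inr f))) inl.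
have cdI : injective cd.
  apply: skolem_code_inj; try by move=> ? ? [].
  by move=> a b a' b' /pI e; case: e => -> ->.
have [|/(smallP C).1//|KL] := @injects_sum K {x | C x}
  (Defs.fsym L + Defs.rsym L + nat) K_uncountable.
  apply: injects_trans KN _.
  have /choice[pre preP] : forall u : {x | range ev x}, exists s, ev s = sval u.
    move=> x; have [s _ sx] := svalP x; by exists s.
  exists (cd \o pre) => -[x xN] [y yN] /= /cdI e.
  by apply: eq_exist; have := preP (exist _ x xN); rewrite e preP.
by have [f fI] := KL; apply: K_large; apply/card_le_injects; exists f.
Qed.

End SmallSets.

(** * The chain condition over extension bases *)

Lemma indiscernible_indisc L (M : structure L) m (C : set M) (a : nat -> 'I_m -> M) :
  indiscernible C a -> indisc C (fun p : nat * 'I_m => a p.1 p.2).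
Proof.
move=> aI P [t [tC tP]] g gI; have [s sP] := vars_in_finite t.
have [k kP] := In_bound (fun v : nat * 'I_m + M => if v is inl p then p.1 else 0) s.
pose rho (v : nat * 'I_m + M) : 'I_k.+1 * 'I_m + M :=
  match v with inl p => inl (inord p.1, p.2) | inr c => inr c end.
have key h : P (fun p => a (h p.1) p.2) <->
    sat (fun v : 'I_k.+1 * 'I_m + M => match v with inl q => a (h q.1) q.2 | inr c => c end)
      (rename rho t).
  rewrite tP sat_rename; apply: sat_ext sP => -[p|c] // /kP lt /=.
  by rewrite inordK // ltnW.
rewrite (key id) (key g); apply: (aI _ _ (fun q : 'I_k.+1 => g q) (fun q => q)).
- by apply/rename_vars; apply: vars_inW tC => -[].
- by move=> q q'; apply: gI.
- by [].
Qed.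

Theorem theorem2p9 (L : language) (T : set (sentence L)) (K : Type)
    (M : structure L) :
  complete_theory T -> monster M K T -> NTP2 M ->
  forall C : set M, small K C -> extension_base C -> chain_condition C.
Proof.
move=> _ [_ K_large sat_M hom_M] ntp2 C smallC extC n m phi a aI nforks [D [finD Ddiv cov]].
apply: nforks.
have sc := @small_setU_countable L M K K_large.
have [N [smallN elemN CN]] := small_elementary K_large smallC.
have [m0] := Defs.nonempty M.
have [ds dsE] := finite_set_In finD; subst D.
pose d i := nth (inst phi (a 0)) ds i.
have dP i : i < size ds -> divides C (d i) by move=> lt; apply: Ddiv; apply: nth_In.
(* The dividing formulas have tuples of various lengths; padding them with [m0] lets all be read off
   one countable tuple [b]. *)
have /choice[eQ eQP] : forall i, exists eQ : (nat -> M) * (('I_n + nat -> M) -> Prop),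
    i < size ds -> definable C eQ.2 /\ forall x, psat x (d i) <-> eQ.2 (sumf x eQ.1).
  move=> i; have [lt|_] := boolP (i < size ds); last by exists (fun=> m0, fun=> True).
  have [q [psi [e [-> _]]]] := dP i lt.
  exists (fun j => if insub j is Some l then e l else m0,
          fun y => sat (sumf (y \o inl) (fun l : 'I_q => y (inr (val l)))) psi) => _; split.
    apply: (definable_coord (F := fun y => sumf (y \o inl) (fun l : 'I_q => y (inr (val l))))
      _ (definable_sat C psi)).
    by move=> [l|l]; left; [exists (inl l)|exists (inr (val l))].
  move=> x; rewrite psat_inst /=.
  have -> // : (fun l : 'I_q => if insub (val l) is Some l' then e l' else m0) = e.
  by apply: funext => l; rewrite valK.
pose b (p : nat * nat) := (eQ p.1).1 p.2.
pose R i (y : 'I_n + nat * nat -> M) := (eQ i).2 (sumf (y \o inl) (fun j => y (inr (i, j)))).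
have Rb i x : i < size ds -> psat x (d i) <-> R i (sumf x b) by move=> /eQP[_].
(* Here forking becomes dividing; the conjunction implies this disjunction and so divides as
   well. *)
have union : dividing C (fun x => exists2 i, i < size ds & R i (sumf x b)).
  apply: (dividing_union sat_M hom_M sc ntp2 smallN elemN CN extC) => i lt; split.
    apply: (definable_coord (F := fun y => sumf (y \o inl) (fun j => y (inr (i, j)))) _
      (eQP i lt).1).
    by move=> [l|j]; left; [exists (inl l)|exists (inr (i, j))].
  have := divides_dividing hom_M sc smallC (dP i lt); apply: dividing_sub => x.
  by rewrite (Rb i x lt).
pose u (p : nat * 'I_m) := a p.1 p.2.
have dv : dividing C (fun x => sat (sumf x (row u 0)) phi).
  apply: (dividing_chain sat_M hom_M sc ntp2 smallN elemN CN extC (definable_sat C phi)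
    (indiscernible_indisc aI)).
  apply: dividing_sub union => x [h0 h1].
  have [|psi /(In_nth (inst phi (a 0)))[i lt <-] psix] := cov x.
    by split; apply/psat_inst.
  by exists i => //; apply/Rb.
have [psi [psidiv psiP]] := dividing_divides (definable_sat C phi) dv.
exists [set psi]; split; first exact: finite_set1.
  by move=> _ ->.
by move=> x /psat_inst h; exists psi => //; apply/psiP.
Qed.
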